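(* Let $D: f=0$ be a degree $d$ hypersurface in the complex projective space $\mathbb{P}^n$ having only isolated singularities, let $J=J_f$ be its Jacobian ideal, $\widehat J$ the saturation of $J$, and $T=(n+1)(d-2)$. Then $\widehat J_k=J_k$ for all $k\geq \max(T-ct(D),st(D))$.
   Context: Let $S=\mathbb{C}[x_0,\dots,x_n]$ with its standard grading and $f\in S_d$ with partial derivatives $f_0,\dots,f_n$. The Jacobian ideal is $J_f=(f_0,\dots,f_n)\subset S$ and $M(f)=S/J_f$ is the graded Milnor algebra. For a homogeneous ideal $I\subset S$, the saturation $\widehat I$ is the set of $s\in S$ such that for every $i=0,\dots,n$ there is a positive integer $m_i$ with $x_i^{m_i}s\in I$; a subscript $k$ denotes the degree $k$ homogeneous component. $f_s\in S_d$ denotes any homogeneous polynomial of degree $d$ such that $f_s=0$ is a smooth hypersurface in $\mathbb{P}^n$ (the dimensions $\dim M(f_s)_k$ do not depend on the choice). $\tau(D)$ is the total Tjurina number of $D$, the sum of the Tjurina numbers of all singularities of $D$. Coincidence threshold: $ct(D)=\max\{q : \dim M(f)_k=\dim M(f_s)_k \text{ for all } k\le q\}$ (to be read as $+\infty$ if $D$ is smooth). Stability threshold: $st(D)=\min\{q : \dim M(f)_k=\tau(D)\text{ for all }k\ge q\}$. *)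

(* Defs.v *)
From HB Require Import structures.
From mathcomp Require Import all_boot all_order all_algebra.
(* mpoly must be imported before the mathcomp-analysis files: the converse order
   makes their notation levels clash. *)
From mathcomp Require Import complex mpoly.
From mathcomp Require Import boolp classical_sets cardinality fsbigop.
From mathcomp Require Import reals ereal.

Set Implicit Arguments.
Unset Strict Implicit.
Unset Printing Implicit Defensive.

Import Order.TTheory GRing.Theory Num.Theory.

Local Open Scope classical_set_scope.
Local Open Scope ring_scope.

Section QuotientDimension.
Variables (K : fieldType) (V : lmodType K).
Implicit Types U W : set V.

(* The classes of the e_i form a basis of the image of U in V / W, that is of
   U / (U `&` W), for linear subspaces U and W of V. *)
Definition quotient_basis U W (r : nat) (e : 'I_r -> V) : Prop :=
  (forall i, U (e i)) /\
  (forall u, U u -> exists! c : 'rV[K]_r, W (u - \sum_i c 0 i *: e i)).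

(* The dimension of U / (U `&` W); the value is 0 if this is infinite. *)
Definition quotient_dim U W : nat :=
  xget 0%N [set r | exists e : 'I_r -> V, quotient_basis U W e].

End QuotientDimension.

(* The ideal of the subring A of S generated by the family g of elements of A. *)
Definition ideal_in (S : comNzRingType) (A : set S) (I : finType) (g : I -> S) :
    set S :=
  [set s | exists2 a : I -> S, (forall i, A (a i)) & s = \sum_i a i * g i].

Section RationalFunctions.
Variables (K : fieldType) (n : nat).

Definition ratfun : Type := {fraction {mpoly K[n]}}.
HB.instance Definition _ := GRing.Field.on ratfun.

Definition ratfun_const (a : K) : ratfun := FracField.tofrac (a%:MP_[n]).

Definition ratfun_scale (a : K) (v : ratfun) : ratfun := ratfun_const a * v.

Fact ratfun_scaleA a b v :
  ratfun_scale a (ratfun_scale b v) = ratfun_scale (a * b) v.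
Proof. by rewrite /ratfun_scale /ratfun_const mulrA mpolyCM rmorphM. Qed.

Fact ratfun_scale1 : left_id 1 ratfun_scale.
Proof. by move=> v; rewrite /ratfun_scale /ratfun_const rmorph1 mul1r. Qed.

Fact ratfun_scaleDr : right_distributive ratfun_scale +%R.
Proof. by move=> a u v; rewrite /ratfun_scale mulrDr. Qed.

Fact ratfun_scaleDl v : {morph ratfun_scale^~ v : a b / a + b}.
Proof. by move=> a b; rewrite /ratfun_scale /ratfun_const mpolyCD rmorphD mulrDl. Qed.

HB.instance Definition _ := GRing.Zmodule_isLmodule.Build K ratfun
  ratfun_scaleA ratfun_scale1 ratfun_scaleDr ratfun_scaleDl.

(* The local ring at the point q of affine n-space: the rational functions that
   are regular at q. *)
Definition local_ring (q : 'I_n -> K) : set ratfun :=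
  [set x | exists h u : {mpoly K[n]},
     u.@[q] != 0 /\ x = FracField.tofrac h / FracField.tofrac u].

(* The generators g, dg/dy_0, ..., dg/dy_(n-1) of the Tjurina ideal of g. *)
Definition tjurina_gen (g : {mpoly K[n]}) (o : option 'I_n) : ratfun :=
  FracField.tofrac (if o is Some j then g^`M(j) else g).

(* The Tjurina number of the affine hypersurface g = 0 at q. *)
Definition tjurina_number (g : {mpoly K[n]}) (q : 'I_n -> K) : nat :=
  quotient_dim (local_ring q) (ideal_in (local_ring q) (tjurina_gen g)).

End RationalFunctions.

Section ProjectiveHypersurface.
Variables (K : fieldType) (n : nat).
Implicit Types (f h s : {mpoly K[n.+1]}) (p q : 'rV[K]_n.+1).

(* Each point of the projective space P^n is represented by its unique vector of
   homogeneous coordinates whose first nonzero entry is 1. *)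
Definition proj_space : set 'rV[K]_n.+1 :=
  [set p : 'rV[K]_n.+1 | exists i : 'I_n.+1,
     p 0 i = 1 /\ forall j : 'I_n.+1, (j < i)%N -> p 0 j = 0].

Definition sing_locus f : set 'rV[K]_n.+1 :=
  [set p : 'rV[K]_n.+1 |
     [/\ proj_space p, f.@[p 0] = 0 & forall i, (f^`M(i)).@[p 0] = 0]].

Definition smooth_hypersurface f : Prop := sing_locus f = set0.

(* Every point of the singular locus is isolated in it, for the Zariski topology:
   the basic open subsets of P^n are the loci h != 0 with h homogeneous. *)
Definition isolated_singularities f : Prop :=
  forall p, sing_locus f p ->
    exists (e : nat) h, [/\ h \is e.-homog, h.@[p 0] != 0 &
      forall q, sing_locus f q -> h.@[q 0] != 0 -> q = p].

(* The equation of f = 0 in the affine chart x_i != 0, where x_i is set to 1 and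
   the variable y_l stands for x_(lift i l) / x_i. *)
Definition dehomogenize (i : 'I_n.+1) f : {mpoly K[n]} :=
  f \mPo [tuple if unlift i j is Some l then 'X_l else 1 | j < n.+1].

Definition affine_coord (i : 'I_n.+1) p : 'I_n -> K :=
  fun l => p 0 (lift i l) / p 0 i.

Definition proj_chart p : 'I_n.+1 := odflt ord0 [pick i | p 0 i != 0].

Definition tjurina_at f p : nat :=
  let i := proj_chart p in tjurina_number (dehomogenize i f) (affine_coord i p).

(* A sum over a set, which is 0 if there are infinitely many nonzero terms; an
   isolated singular locus is finite. *)
Definition total_tjurina f : nat :=
  (\sum_(p \in sing_locus f) tjurina_at f p)%N.

Definition homog_comp (k : nat) : set {mpoly K[n.+1]} := [set s | s \is k.-homog].

Definition jacobian_ideal f : set {mpoly K[n.+1]} :=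
  ideal_in setT (fun i : 'I_n.+1 => f^`M(i)).

Definition saturation (I : set {mpoly K[n.+1]}) : set {mpoly K[n.+1]} :=
  [set s | forall i : 'I_n.+1, exists2 m : nat, (0 < m)%N & I ('X_i ^+ m * s)].

(* The dimension of the degree k component of the Milnor algebra S / J_f. *)
Definition milnor_dim f (k : nat) : nat :=
  quotient_dim (homog_comp k) (jacobian_ideal f).

End ProjectiveHypersurface.

Section Thresholds.
Variables (R : realType) (n : nat).
Implicit Types f fs : {mpoly R[i][n.+1]}.

(* The supremum of a set of natural numbers is its maximum, or +oo if the set is
   unbounded. *)
Definition coincidence_threshold f fs : \bar R :=
  ereal_sup [set (q%:R)%:E | q in
    [set q : nat | forall k, (k <= q)%N -> milnor_dim f k = milnor_dim fs k]].

(* The infimum of a nonempty set of natural numbers is its minimum. *)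
Definition stability_threshold f : \bar R :=
  ereal_inf [set (q%:R)%:E | q in
    [set q : nat | forall k, (q <= k)%N -> milnor_dim f k = total_tjurina f]].

End Thresholds.

(* Main.v *)
(* Put [e = d - 1]. As the singular locus is finite, there are [n] linear combinations [g]
   of the partial derivatives and a linear form [l] such that [(g, l)] contains all forms of
   large degree, with [J = I + (f_0)] for [I = (g)]. So [S / I] is a one-dimensional
   complete intersection on which [l] is regular. Let [A_k] be its degree [k] part divided
   by [l ^ k]; these increase to a finite-dimensional algebra [A], reached at
   [t = n (e - 1)]. Gorenstein duality says that, for the pairing
   [A * A -> A / A_(t-1)], the orthogonal of [A_k] is [A_(t-1-k)].

   The Tjurina number is only used through [st]: [dim M(f)_j] is constant for [j >= k]. The
   bound by [T - ct] says that [dim M(f) = dim M(f_s)] in degree [T - k = (t-1-k) + e].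
   Since the Hilbert function of a regular sequence only depends on its length, this means
   that [f_0] is not a zero divisor on [A_(t-1-k)]. By duality [A_k + f_0 A = A], so
   multiplication by a power of [l] maps [M(f)_k] onto [M(f)_(k+r)]; as the dimensions
   agree it is injective, and a form of degree [k] in the saturation lies in [J].

   Regularity and duality for forms of degree [e] generating an ideal of finite colength
   are transported from the powers [x_i ^ e] by exchanging elements one at a time. *)
Require Import Defs.
From HB Require Import structures.
From mathcomp Require Import all_boot all_order all_algebra.
From mathcomp Require Import complex mpoly.
From mathcomp Require Import boolp classical_sets cardinality fsbigop.
From mathcomp Require Import reals ereal.
From mathcomp Require Import zify ring.

Set Implicit Arguments.
Unset Strict Implicit.
Unset Printing Implicit Defensive.

Import Order.TTheory GRing.Theory Num.Theory.

Local Open Scope classical_set_scope.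
Local Open Scope ring_scope.

(** * Degrees of monomials and linear forms *)

Section HomogeneousMonomials.
Variables (K : fieldType) (n : nat).

Lemma mpolyX_homog m : 'X_[m] \is [in K[n], (mdeg m).-homog].
Proof. by rewrite dhomogX. Qed.

Lemma dhomog_mdeg k (p : {mpoly K[n]}) m :
  p \is k.-homog -> m \in msupp p -> mdeg m = k.
Proof. by move=> /dhomogP; apply. Qed.

Lemma X_homog i : 'X_i \is [in K[n], 1.-homog].
Proof. by rewrite -(mdeg1 i); exact: mpolyX_homog. Qed.

Lemma linear_form_powX (l : {mpoly K[n]}) k : l \is 1.-homog -> l ^+ k \is k.-homog.
Proof. by move=> hl; have := dhomogMn k hl; rewrite mul1n. Qed.

End HomogeneousMonomials.

(** * Homogeneous ideals as sets, regular sequences and their reordering *)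

Section Ideals.
Variables (K : fieldType) (n : nat).
Local Notation S := {mpoly K[n.+1]}.
Implicit Types (I J : set S) (p q a b : S) (s : seq S).

Record homog_ideal I : Prop := HomogIdeal {
  hideal0 : I 0;
  hidealD : forall p q, I p -> I q -> I (p + q);
  hidealM : forall p q, I q -> I (p * q);
  hideal_pihomog : forall k p, I p -> I (pihomog mdeg k p) }.

(** The ideal [(I, a)]; iterated by [adjs]. *)
Definition adj I a : set S := [set p | exists q, I (p - q * a)].

Fixpoint adjs I s : set S := if s is a :: s' then adjs (adj I a) s' else I.

Definition regular_mod I a := forall p, I (p * a) -> I p.

Fixpoint regular_seq I s : Prop :=
  if s is a :: s' then regular_mod I a /\ regular_seq (adj I a) s' else True.

(** One degree is enough: a homogeneous ideal then contains all forms of higher degree, by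
    [hideal_deg]. *)
Definition finite_colength I := exists N : nat, forall p, p \is N.-homog -> I p.

Lemma homog_ideal0 : homog_ideal [set 0].
Proof.
split=> //= [p q -> ->|p q ->|k p ->]; by rewrite ?addr0 ?mulr0 ?raddf0.
Qed.

Section HomogIdealTheory.
Variables (I : set S) (hI : homog_ideal I).

Lemma hidealMr p q : I p -> I (p * q).
Proof. by rewrite mulrC; exact: hidealM. Qed.

Lemma hidealN p : I p -> I (- p).
Proof. by rewrite -mulN1r; apply: hidealM. Qed.

Lemma hidealB p q : I p -> I q -> I (p - q).
Proof. by move=> Ip /hidealN; apply: hidealD. Qed.

Lemma hidealZ c p : I p -> I (c *: p).
Proof. by rewrite -mul_mpolyC; apply: hidealM. Qed.

Lemma hidealZK c p : c != 0 -> I (c *: p) -> I p.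
Proof. by move=> c0 /(hidealZ c^-1); rewrite scalerA mulVf // scale1r. Qed.

Lemma hidealBr p q : I q -> I (p - q) -> I p.
Proof. by move=> Iq Ipq; rewrite -(subrK q p); apply: hidealD. Qed.

Lemma hideal_sum (T : Type) (r : seq T) (P : pred T) (F : T -> S) :
  (forall i, P i -> I (F i)) -> I (\sum_(i <- r | P i) F i).
Proof. by move=> h; apply: big_ind => //; [exact: hideal0|exact: hidealD]. Qed.

Lemma hideal_homog p : (forall k, I (pihomog mdeg k p)) -> I p.
Proof.
move=> h; rewrite (pihomog_partitionE (leqnn (mmeasure mdeg p))).
exact: hideal_sum.
Qed.

Lemma hideal_monom k p :
  p \is k.-homog -> (forall m, mdeg m = k -> I 'X_[m]) -> I p.
Proof.
move=> /dhomogP hp h; rewrite (mpolyE p) big_seq_cond.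
apply: hideal_sum => m; rewrite andbT => /hp /h; exact: hidealZ.
Qed.

End HomogIdealTheory.

Lemma pihomogM e a q k : a \is e.-homog ->
  pihomog mdeg k (q * a) = if (e <= k)%N then pihomog mdeg (k - e) q * a else 0.
Proof.
move=> ha; set N := maxn (mmeasure mdeg q) k.+1.
have hN := pihomog_partitionE (leq_maxl (mmeasure mdeg q) k.+1).
rewrite -/N in hN.
rewrite {1}hN mulr_suml raddf_sum /=.
have hi (i : 'I_N) : pihomog mdeg k (pihomog mdeg i q * a) =
    if (i + e == k)%N then pihomog mdeg i q * a else 0.
  have hh : pihomog mdeg i q * a \is (i + e).-homog.
    by apply: dhomogM => //; exact: pihomogP.
  case: eqP => [<-|/eqP ne]; first by rewrite pihomog_dE.
  by rewrite (pihomog_ne0 ne).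
under eq_bigr do rewrite hi.
rewrite -big_mkcond /=; case: leqP => ek; last first.
  by rewrite big_pred0 // => i; apply/negbTE; lia.
have hk : (k - e < N)%N by rewrite /N; lia.
rewrite (big_pred1 (Ordinal hk)) // => i; apply/eqP/eqP => [h|-> /=]; last lia.
by apply: val_inj => /=; lia.
Qed.

Lemma adj_hideal I e a : homog_ideal I -> a \is e.-homog -> homog_ideal (adj I a).
Proof.
move=> hI ha; split.
- by exists 0; rewrite mul0r subr0; exact: hideal0.
- move=> p q [u hu] [v hv]; exists (u + v).
  by rewrite mulrDl opprD addrACA; exact: hidealD.
- by move=> p q [u hu]; exists (p * u); rewrite -mulrA -mulrBr; exact: hidealM.
- move=> k p [u /(hideal_pihomog hI k)]; rewrite raddfB /= (pihomogM _ _ ha).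
  by case: leqP => _ h; [exists (pihomog mdeg (k - e) u)|exists 0; rewrite mul0r].
Qed.

Lemma adjs_homog_ideal I s : homog_ideal I ->
  {in s, forall a, exists e, a \is e.-homog} -> homog_ideal (adjs I s).
Proof.
elim: s I => [|a s IH] I hI hs //=; apply: IH => [|b bs].
  have [e ha] : exists e, a \is e.-homog by apply: hs; rewrite mem_head.
  exact: adj_hideal ha.
by apply: hs; rewrite inE bs orbT.
Qed.

Lemma adjs_hideal I e s : homog_ideal I -> {in s, forall a, a \is e.-homog} ->
  homog_ideal (adjs I s).
Proof. by move=> hI hs; apply: adjs_homog_ideal => // a /hs ha; exists e. Qed.

Lemma sub_adj I a : I `<=` adj I a.
Proof. by move=> p Ip; exists 0; rewrite mul0r subr0. Qed.

Lemma adj_gen I a q : homog_ideal I -> adj I a (q * a).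
Proof. by move=> hI; exists q; rewrite subrr; exact: hideal0. Qed.

Lemma adj_mono I J a : I `<=` J -> adj I a `<=` adj J a.
Proof. by move=> IJ p [q hq]; exists q; apply: IJ. Qed.

Lemma sub_adjs I s : I `<=` adjs I s.
Proof.
elim: s I => [|a s IH] I //=; apply: subset_trans (IH _); exact: sub_adj.
Qed.

Lemma adj_min I J a : homog_ideal J -> I `<=` J -> J a -> adj I a `<=` J.
Proof.
move=> hJ IJ Ja p [q /IJ h]; rewrite -(subrK (q * a) p).
by apply: hidealD => //; exact: hidealM.
Qed.

Lemma adjs_min I J s : homog_ideal J -> I `<=` J ->
  {in s, forall a, J a} -> adjs I s `<=` J.
Proof.
move=> hJ; elim: s I => [|a s IH] I IJ hs //=; apply: IH.
  by apply: adj_min => //; apply: hs; rewrite mem_head.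
by move=> b bs; apply: hs; rewrite inE bs orbT.
Qed.

Lemma adjC I a b : adj (adj I a) b = adj (adj I b) a.
Proof.
by apply/seteqP; split=> p [q [r h]]; exists r; exists q; rewrite addrAC.
Qed.

Lemma adjs_rcons I s a : adjs I (rcons s a) = adj (adjs I s) a.
Proof. by elim: s I => //=. Qed.

Lemma adjs_adj I s a : adjs (adj I a) s = adj (adjs I s) a.
Proof. by elim: s I => [|b s IH] I //=; rewrite adjC IH. Qed.

Lemma adjs_gen I s a : homog_ideal I -> a \in s -> adjs I s a.
Proof.
move=> hI; elim: s I hI => [|b s IH] I hI //=.
have hb : adj I b b by rewrite -[X in adj _ _ X]mul1r; exact: adj_gen.
rewrite inE => /predU1P [->|]; first exact: sub_adjs.
rewrite adjs_adj => /(IH _ hI); exact: sub_adj.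
Qed.

Lemma adjsP I s p : adjs I s p <->
  exists q : nat -> S, I (p - \sum_(i < size s) q i * s`_i).
Proof.
elim: s I p => [|a s IH] I p /=.
  split=> [Ip|[q]]; last by rewrite big_ord0 subr0.
  by exists (fun=> 0); rewrite big_ord0 subr0.
rewrite IH; split=> [[q [u h]]|[q h]].
  exists (fun i => if i is i'.+1 then q i' else u).
  by rewrite big_ord_recl /= opprD addrA addrAC.
exists (fun i => q i.+1), (q 0%N); move: h.
by rewrite big_ord_recl /= opprD addrA addrAC.
Qed.

(* For [k < e] the truncated degree [k - e] is harmless: then [q = 0]. *)
Lemma adj_homogP I e a k p : homog_ideal I -> a \is e.-homog -> p \is k.-homog ->
  adj I a p -> exists2 q, q \is (k - e).-homog & I (p - q * a).
Proof.
move=> hI ha hp [q /(hideal_pihomog hI k)].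
rewrite raddfB /= (pihomogM _ _ ha) (pihomog_dE hp).
case: leqP => _ h; first by exists (pihomog mdeg (k - e) q) => //; exact: pihomogP.
by exists 0; rewrite ?mul0r // dhomog0.
Qed.

Lemma adj_lt I e a k p : homog_ideal I -> a \is e.-homog -> p \is k.-homog ->
  (k < e)%N -> adj I a p -> I p.
Proof.
move=> hI ha hp ke [q /(hideal_pihomog hI k)].
by rewrite raddfB /= (pihomogM _ _ ha) (pihomog_dE hp) leqNgt ke subr0.
Qed.

Lemma regular_mod_homog I e a : homog_ideal I -> a \is e.-homog ->
  (forall k p, p \is k.-homog -> I (p * a) -> I p) -> regular_mod I a.
Proof.
move=> hI ha h p Ipa; apply: (hideal_homog hI) => k.
apply: (h k); first exact: pihomogP.
by have := hideal_pihomog hI (k + e) Ipa; rewrite (pihomogM _ _ ha) leq_addl addnK.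
Qed.

Lemma regular_modX I a k : regular_mod I a -> regular_mod I (a ^+ k).
Proof.
move=> ra; elim: k => [|k IH] p; first by rewrite expr0 mulr1.
by rewrite exprSr mulrA => /ra /IH.
Qed.

Lemma regular_modXW I a k : homog_ideal I -> (0 < k)%N ->
  regular_mod I (a ^+ k) -> regular_mod I a.
Proof.
case: k => // k hI _ ra p Ipa; apply: ra.
by rewrite exprS mulrA; exact: hidealMr.
Qed.

Lemma regular_seq_rcons I s a :
  regular_seq I (rcons s a) <-> regular_seq I s /\ regular_mod (adjs I s) a.
Proof.
elim: s I => [|b s IH] I /=; first by intuition.
by rewrite IH; intuition.
Qed.

(* Graded Nakayama makes [b] regular modulo [I] itself. *)
Lemma regular_swap I e a b : homog_ideal I -> (0 < e)%N -> a \is e.-homog ->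
  b \is e.-homog -> regular_mod I a -> regular_mod (adj I a) b ->
  regular_mod I b /\ regular_mod (adj I b) a.
Proof.
move=> hI e0 ha hb ra rb.
have rIb : regular_mod I b.
  apply: (@regular_mod_homog _ e) => // k.
  elim/ltn_ind: k => k IH p hp Ipb.
  have /rb/(adj_homogP hI ha hp) : adj I a (p * b) by apply: sub_adj.
  move=> [t ht Ipt]; case: (ltnP k e) => ke.
    by apply: (adj_lt hI ha hp ke); exists t.
  apply: (hidealBr hI _ Ipt); apply: (hidealMr hI); apply: (IH (k - e)%N) => //.
    by lia.
  apply: ra; rewrite mulrAC; apply: (hidealBr hI Ipb).
  have -> : t * a * b - p * b = - ((p - t * a) * b) by ring.
  by apply: (hidealN hI); apply: hidealMr.
split=> // p [t h].
have /rb [u hu] : adj I a (t * b).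
  by exists p; rewrite -opprB; exact: (hidealN hI).
exists u; apply: ra.
have -> : (p - u * b) * a = (p * a - t * b) + (t - u * a) * b by ring.
by apply: (hidealD hI) => //; exact: hidealMr.
Qed.

(** Successive swaps of neighbours carry [a] through the sequence; [adjC] identifies the ideals met
    on the way. *)
Lemma regular_seq_rot I e a s : homog_ideal I -> (0 < e)%N ->
  {in a :: s, forall b, b \is e.-homog} ->
  regular_seq I (a :: s) -> regular_seq I (rcons s a).
Proof.
move=> hI e0; elim: s I hI => [|b s IH] I hI hs //=.
have ha : a \is e.-homog by apply: hs; rewrite mem_head.
have hb : b \is e.-homog by apply: hs; rewrite !inE eqxx orbT.
move=> [ra [rb rs]]; have [rIb rba] := regular_swap hI e0 ha hb ra rb.
split=> //; apply: IH; first exact: adj_hideal hb.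
  move=> c; rewrite inE => cs; apply: hs; rewrite !inE.
  by case/orP: cs => ->; rewrite ?orbT.
by split=> //; rewrite adjC.
Qed.

Lemma regular_seq_rotr I e a s : homog_ideal I -> (0 < e)%N ->
  {in a :: s, forall b, b \is e.-homog} ->
  regular_seq I (rcons s a) -> regular_seq I (a :: s).
Proof.
move=> hI e0; elim: s I hI => [|b s IH] I hI hs //=.
have ha : a \is e.-homog by apply: hs; rewrite mem_head.
have hb : b \is e.-homog by apply: hs; rewrite !inE eqxx orbT.
move=> [rb /IH [||rba rs]]; first exact: adj_hideal hb.
  move=> c; rewrite inE => cs; apply: hs; rewrite !inE.
  by case/orP: cs => ->; rewrite ?orbT.
by have [] := regular_swap hI e0 hb ha rb rba; rewrite adjC in rs.
Qed.

Lemma finite_colengthS I J : I `<=` J -> finite_colength I -> finite_colength J.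
Proof. by move=> IJ [N h]; exists N => p /h /IJ. Qed.

Lemma hideal_deg I N k : homog_ideal I -> (forall p, p \is N.-homog -> I p) ->
  (N <= k)%N -> forall p, p \is k.-homog -> I p.
Proof.
move=> hI h /subnKC <-; elim: (k - N)%N => {k} [|k IH] p.
  by rewrite addn0; exact: h.
move=> hp; apply: (hideal_monom hI hp) => m hm.
have [j mj] : exists j, (0 < m j)%N.
  apply/existsP; apply: contraLR isT; rewrite negb_exists => /forallP m0.
  move: hm; rewrite mdegE big1 ?addnS // => i _; apply/eqP.
  by have := m0 i; rewrite -leqNgt leqn0.
have hU : (U_(j) <= m)%MM.
  by apply/mnm_lepP => i; rewrite mnm1E; case: eqP => // <-.
rewrite -(submK hU) mpolyXD mulrC; apply: hidealM => //; apply: IH.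
by rewrite dhomogX; move: hm; rewrite -{1}(submK hU) mdegD mdeg1 addn1 addnS => -[/eqP].
Qed.

Lemma finite_colengthP I : homog_ideal I -> finite_colength I ->
  exists N : nat, forall k p, (N <= k)%N -> p \is k.-homog -> I p.
Proof. by move=> hI [N h]; exists N => k p Nk; exact: (hideal_deg hI h). Qed.

Definition socle_free I k := forall s : S,
  s \is k.-homog -> (forall j, I ('X_j * s)) -> I s.

Definition colon I a : set S := [set p | I (p * a)].

Lemma colon_hideal I k a : homog_ideal I -> a \is k.-homog ->
  homog_ideal (colon I a).
Proof.
move=> hI ha; rewrite /colon; split=> /=.
- by rewrite mul0r; exact: hideal0.
- by move=> p q; rewrite mulrDl; exact: hidealD.
- by move=> p q; rewrite -mulrA; exact: hidealM.
- move=> i p /(hideal_pihomog hI (i + k)).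
  by rewrite (pihomogM _ _ ha) leq_addl addnK.
Qed.

End Ideals.

(** * Finite colength along the line joining two sequences of forms *)

Section Pencils.
Variables (K : fieldType) (n : nat).
Local Notation S := {mpoly K[n.+1]}.
Implicit Types (I J : set S) (p q : S) (a b s : seq S).

Lemma hideal_unitmx I D (A : 'M[K]_D) (v : 'I_D -> S) : homog_ideal I ->
  A \in unitmx -> (forall i, I (\sum_j A i j *: v j)) -> forall i, I (v i).
Proof.
move=> hI uA h i.
have -> : v i = \sum_j (invmx A) i j *: \sum_l A j l *: v l.
  transitivity (\sum_l (invmx A *m A) i l *: v l).
    rewrite mulVmx // (bigD1 i) //= big1 => [|l li].
      by rewrite mxE eqxx scale1r addr0.
    by rewrite mxE eq_sym (negbTE li) scale0r.
  under [RHS]eq_bigr do rewrite scaler_sumr.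
  rewrite exchange_big /=; apply: eq_bigr => l _.
  by rewrite mxE scaler_suml; apply: eq_bigr => j _; rewrite scalerA.
by apply: (hideal_sum hI) => j _; apply: hidealZ.
Qed.

(** [P] is the determinant of the matrix with parameter ['X]; its value at 0 is 1. *)
Lemma unitmx_pencil D (M : 'M[K]_D) : exists P : {poly K},
  P.[0] != 0 /\ forall x, P.[x] != 0 -> 1%:M + x *: M \in unitmx.
Proof.
pose P := \det (1%:M + 'X *: map_mx polyC M).
have hP x : P.[x] = \det (1%:M + x *: M).
  rewrite -horner_evalE -det_map_mx; congr (\det _); apply/matrixP => i j.
  by rewrite !mxE /= horner_evalE hornerD hornerM hornerX hornerC hornerMn hornerC.
exists P; split=> [|x]; first by rewrite hP scale0r addr0 det1 oner_neq0.
by rewrite hP unitmxE unitfE.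
Qed.

Lemma adjs_homogP I e a k p : homog_ideal I ->
  {in a, forall x, x \is e.-homog} -> (e <= k)%N -> p \is k.-homog ->
  adjs I a p -> exists q : nat -> S, (forall i, q i \is (k - e).-homog) /\
    I (p - \sum_(i < size a) q i * a`_i).
Proof.
move=> hI ha ek hp /adjsP [q /(hideal_pihomog hI k)].
rewrite raddfB /= (pihomog_dE hp) (raddf_sum (pihomog mdeg k)) /= => h.
exists (fun i => pihomog mdeg (k - e) (q i)); split=> [i|]; first exact: pihomogP.
suff -> : \sum_(i < size a) pihomog mdeg (k - e) (q i) * a`_i =
    \sum_(i < size a) pihomog mdeg k (q i * a`_i) by [].
by apply: eq_bigr => i _; rewrite (pihomogM _ _ (ha _ (mem_nth 0 (ltn_ord i)))) ek.
Qed.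

(** The point of parameter [x] on the line through [a] (at 0) and [b] (at 1). *)
Definition pencil (x : K) a b : seq S := [seq u.1 + x *: (u.2 - u.1) | u <- zip a b].

Lemma size_pencil x a b : size a = size b -> size (pencil x a b) = size b.
Proof. by move=> ab; rewrite size_map size_zip ab minnn. Qed.

Lemma nth_pencil x a b i : size a = size b ->
  (pencil x a b)`_i = a`_i + x *: (b`_i - a`_i).
Proof.
move=> ab; case: (ltnP i (size b)) => ib.
  by rewrite (nth_map (0, 0)) ?size_zip ?ab ?minnn // nth_zip.
by rewrite !nth_default ?size_pencil ?ab // subrr scaler0 addr0.
Qed.

Lemma pencil_homog x e a b : size a = size b ->
  {in a, forall u, u \is e.-homog} -> {in b, forall u, u \is e.-homog} ->
  {in pencil x a b, forall u, u \is e.-homog}.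
Proof.
move=> ab ha hb _ /(nthP 0) [i + <-]; rewrite size_pencil // nth_pencil // => ib.
have hai : a`_i \is e.-homog by apply: ha; rewrite mem_nth // ab.
by apply: rpredD => //; apply/rpredZ/rpredB => //; apply: hb; rewrite mem_nth.
Qed.

Lemma pencilC x a b : size a = size b -> pencil (1 - x) b a = pencil x a b.
Proof.
move=> ab; apply: (@eq_from_nth _ 0) => [|i _].
  by rewrite !size_pencil.
rewrite !nth_pencil //; have -> : a`_i - b`_i = - (b`_i - a`_i) by rewrite opprB.
rewrite scalerN scalerBl scale1r opprB addrCA [in RHS]addrC; congr (_ + _).
by rewrite opprB addrC subrK.
Qed.

(* Writing a basis of [S_N] as combinations of [a] modulo [I] and moving [a]
   along the pencil perturbs the identity matrix linearly. *)
Lemma finite_colength_pencil I e a b : homog_ideal I -> size a = size b ->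
  {in a, forall u, u \is e.-homog} -> {in b, forall u, u \is e.-homog} ->
  finite_colength (adjs I a) ->
  exists P : {poly K}, P.[0] != 0 /\
    forall x, P.[x] != 0 -> finite_colength (adjs I (pencil x a b)).
Proof.
move=> hI ab ha hb /(finite_colengthP (adjs_hideal hI ha)) [N0 hN0].
set N := maxn N0 e; have eN : (e <= N)%N by rewrite leq_maxr.
pose X := vbasis {:dhomog n.+1 K N}.
have hX (i : 'I_(\dim {:dhomog n.+1 K N})) :
    exists q : nat -> S, (forall j, q j \is (N - e).-homog) /\
    I (mpoly_of_dhomog X`_i - \sum_(j < size a) q j * a`_j).
  apply: (adjs_homogP hI ha eN); first exact: dhomog_is_dhomog.
  by apply: (hN0 N); rewrite ?leq_maxl //; exact: dhomog_is_dhomog.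
have [Q hQ] := choice hX.
pose g i : S := \sum_(j < size a) Q i j * (b`_j - a`_j).
have hg i : g i \is N.-homog.
  apply: rpred_sum => j _; rewrite -(subnK eN); apply: dhomogM; first exact: (hQ i).1.
  by apply: rpredB; [apply: hb|apply: ha]; rewrite mem_nth // -ab.
pose G i : dhomog n.+1 K N := DHomog (hg i).
pose M := \matrix_(i, j) coord X j (G i).
have [P [P0 hP]] := unitmx_pencil M.
exists P; split=> // x /hP uM; exists N => p hp.
have hJ : homog_ideal (adjs I (pencil x a b)).
  by apply: (@adjs_hideal _ _ _ e) => //; exact: pencil_homog.
suff hXJ (i : 'I_(\dim {:dhomog n.+1 K N})) : adjs I (pencil x a b) (mpoly_of_dhomog X`_i).
  have -> : p = mpoly_of_dhomog (\sum_i coord X i (DHomog hp) *: X`_i).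
    by rewrite -(coord_vbasis (memvf (DHomog hp))).
  rewrite raddf_sum /=; apply: (hideal_sum hJ) => i _; exact: (hidealZ hJ).
move: i; apply: (hideal_unitmx hJ uM) => i.
have -> : \sum_j (1%:M + x *: M) i j *: mpoly_of_dhomog X`_j =
    mpoly_of_dhomog X`_i + x *: g i.
  have -> : g i = \sum_j coord X j (G i) *: mpoly_of_dhomog X`_j.
    rewrite -[LHS]/(mpoly_of_dhomog (G i)) {1}(coord_vbasis (memvf (G i))).
    by rewrite raddf_sum.
  rewrite scaler_sumr -(scale1r (mpoly_of_dhomog X`_i)).
  under eq_bigr do rewrite mxE [_ *: M]lock mxE -lock scalerDl mxE -scalerA mxE.
  rewrite big_split /= (bigD1 i) //= big1 ?addr0 ?eqxx // => j ji.
  by rewrite eq_sym (negbTE ji) scale0r.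
apply/adjsP; exists (Q i); rewrite size_pencil // -ab.
have -> : mpoly_of_dhomog X`_i + x *: g i -
    \sum_(j < size a) Q i j * (pencil x a b)`_j =
    mpoly_of_dhomog X`_i - \sum_(j < size a) Q i j * a`_j.
  rewrite /g scaler_sumr -addrA -sumrB; congr (_ + _).
  rewrite -sumrN; apply: eq_bigr => j _.
  by rewrite nth_pencil // [Q i j * (a`_j + _)]mulrDr -scalerAr opprD addrCA subrr addr0.
exact: (hQ i).2.
Qed.

End Pencils.

(** * Exchange of regular sequences in characteristic zero *)

Lemma exists_nonroot (K : numFieldType) (P : {poly K}) :
  P != 0 -> exists x, P.[x] != 0.
Proof.
move=> P0; apply: contrapT => h.
have hr : all (root P) [seq i%:R | i <- iota 0 (size P)].
  apply/allP => x _; apply/rootP; apply: contrapT => /eqP hx; apply: h.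
  by exists x.
have := max_poly_roots P0 hr; rewrite size_map size_iota ltnn.
rewrite map_inj_uniq ?iota_uniq //; first by move/(_ isT).
by move=> i j /eqP; rewrite eqr_nat => /eqP.
Qed.

Section Exchange.
Variables (K : numFieldType) (n : nat).
Local Notation S := {mpoly K[n.+1]}.
Implicit Types (I J : set S) (p q a b : S) (s : seq S).

Lemma common_pencil I J e s t : homog_ideal I -> homog_ideal J ->
  size s = size t -> {in s, forall u, u \is e.-homog} ->
  {in t, forall u, u \is e.-homog} ->
  finite_colength (adjs I s) -> finite_colength (adjs J t) ->
  exists c : seq S, [/\ size c = size t, {in c, forall u, u \is e.-homog},
    finite_colength (adjs I c) & finite_colength (adjs J c)].
Proof.
move=> hI hJ st hs ht fs ft.
have [P [P0 hP]] := finite_colength_pencil hI st hs ht fs.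
have [Q [Q0 hQ]] := finite_colength_pencil hJ (esym st) ht hs ft.
(* The line from [t] to [s] is the line from [s] to [t] run backwards, so its condition is read at
   [1 - x]. *)
pose Q' := Q \Po (1 - 'X).
have hQ' x : Q'.[x] = Q.[1 - x] by rewrite horner_comp !hornerE.
have [|x] := @exists_nonroot _ (P * Q').
  rewrite mulf_neq0 //; apply/negP => /eqP E; [move: P0|move: (hQ' 1)].
    by rewrite E horner0 eqxx.
  by rewrite E horner0 subrr => /esym/eqP; rewrite (negbTE Q0).
rewrite hornerM mulf_eq0 negb_or hQ' => /andP [Px Qx].
exists (pencil x s t); split; first by rewrite size_pencil.
- exact: pencil_homog.
- exact: hP.
- by rewrite -pencilC //; exact: hQ.
Qed.

(* The relation [a * t = b * s] modulo [I] matches the socle elements [t] modulo [(I, b)]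
   with the socle elements [s] modulo [(I, a)]. *)
Lemma socle_exchange I e a b k : homog_ideal I -> (0 < e)%N -> a \is e.-homog ->
  b \is e.-homog -> regular_mod I a -> regular_mod I b ->
  socle_free (adj I a) k -> socle_free (adj I b) k.
Proof.
move=> hI e0 ha hb ra rb sa t ht xt.
have hIb := adj_hideal hI hb.
(* Modulo [(I, b)] all variables kill [t], hence so does every form of degree at least 1, in
   particular [a]. *)
have /(adj_homogP hI hb (dhomogM ha ht)) [s] : adj I b (a * t).
  apply: (@hideal_deg _ _ _ 1 e (colon_hideal hIb ht)) => // p hp.
  apply: (hideal_monom (colon_hideal hIb ht) hp) => m /eqP /mdeg1P [j /eqP ->].
  exact: xt.
rewrite addKn => hs Is.
have [|v hv] := sa _ hs.
  move=> j; have [u hu] := xt j; exists u; apply: rb.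
  have -> : ('X_j * s - u * a) * b = ('X_j * t - u * b) * a - 'X_j * (a * t - s * b).
    by ring.
  by apply: (hidealB hI); [apply: hidealMr|apply: hidealM].
exists v; apply: ra.
have -> : (t - v * b) * a = (a * t - s * b) + (s - v * a) * b by ring.
by apply: (hidealD hI) => //; apply: hidealMr.
Qed.

(** A power of [a] lies in [(I, b)], so whatever [b] kills modulo [I] is killed by that power, which
    is regular. *)
Lemma regular_exchange1 I e a b : homog_ideal I -> (0 < e)%N -> a \is e.-homog ->
  b \is e.-homog -> regular_mod I a -> finite_colength (adj I b) -> regular_mod I b.
Proof.
move=> hI e0 ha hb ra /(finite_colengthP (adj_hideal hI hb)) [N hN].
have [|q hq] := hN (e * N)%N (a ^+ N) _ (dhomogMn N ha); first by rewrite leq_pmull.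
move=> p pb; apply: (regular_modX (k := N) ra).
have -> : p * a ^+ N = p * (a ^+ N - q * b) + q * (p * b) by ring.
by apply: (hidealD hI); apply: hidealM.
Qed.

(* With [c] generic, the sequences [a :: s], [a :: c], [rcons c a], [rcons c b], [b :: c]
   and [b :: t] are regular in turn. *)
Lemma regular_exchange I e s t : homog_ideal I -> (0 < e)%N -> size s = size t ->
  {in s, forall u, u \is e.-homog} -> {in t, forall u, u \is e.-homog} ->
  regular_seq I s -> finite_colength (adjs I s) -> finite_colength (adjs I t) ->
  regular_seq I t /\
    forall k, socle_free (adjs I s) k -> socle_free (adjs I t) k.
Proof.
move=> + e0; have [m] := ubnP (size t); elim: m I s t => // m IH I.
move=> [|a s] [|b t] //= mt hI [st] hs ht.
have ha : a \is e.-homog by apply: hs; rewrite mem_head.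
have hb : b \is e.-homog by apply: ht; rewrite mem_head.
have hs' : {in s, forall u, u \is e.-homog}.
  by move=> u us; apply: hs; rewrite inE us orbT.
have ht' : {in t, forall u, u \is e.-homog}.
  by move=> u us; apply: ht; rewrite inE us orbT.
have hIa := adj_hideal hI ha; have hIb := adj_hideal hI hb.
move=> [ra rs] /= fs ft.
have [c [ct hc fac fbc]] := common_pencil hIa hIb st hs' ht' fs ft.
have hIc := adjs_hideal hI hc.
have hac : {in a :: c, forall u, u \is e.-homog}.
  by move=> u; rewrite inE => /predU1P [->|/hc].
have hbc : {in b :: c, forall u, u \is e.-homog}.
  by move=> u; rewrite inE => /predU1P [->|/hc].
have cm : (size c < m)%N by rewrite ct; exact: mt.
have [|rac sac] := IH _ s c cm hIa _ hs' hc rs fs fac; first by rewrite ct.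
have : regular_seq I (rcons c a).
  exact: (regular_seq_rot hI e0 hac).
rewrite regular_seq_rcons => -[rc rca].
rewrite !adjs_adj in sac fac fbc; rewrite !adjs_adj in ft *.
have rcb := regular_exchange1 hIc e0 ha hb rca fbc.
have [|rb rbc] := regular_seq_rotr hI e0 hbc; first by rewrite regular_seq_rcons.
rewrite -adjs_adj in fbc.
have [] := IH _ c t _ hIb ct hc ht' rbc fbc; rewrite ?adjs_adj //.
move=> rt sct; split=> // k /sac /(socle_exchange hIc e0 ha hb rca rcb).
exact: sct.
Qed.

End Exchange.

(** * Hilbert functions of homogeneous ideals *)

Section HilbertFunction.
Variables (K : fieldType) (n : nat).
Local Notation S := {mpoly K[n.+1]}.
Local Notation Sk k := (dhomog n.+1 K k).
Implicit Types (I J : set S) (p q a b : S) (s : seq S).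

(** A subspace of maximal dimension inside [P] is all of [P], since adding a further vector of [P]
    would enlarge it. *)
Lemma exists_vspace (V : vectType K) (P : V -> Prop) :
  P 0 -> (forall c u v, P u -> P v -> P (c *: u + v)) ->
  exists U : {vspace V}, forall v, v \in U <-> P v.
Proof.
move=> P0 PD.
pose Q d := `[< exists2 U : {vspace V}, \dim U = d & forall v, v \in U -> P v >].
have Q0 : exists d, Q d.
  exists 0%N; apply/asboolP; exists 0%VS; rewrite ?dimv0 // => v.
  by rewrite memv0 => /eqP ->.
have Qm d : Q d -> (d <= \dim {:V})%N.
  by move=> /asboolP [U <- _]; rewrite dimvS ?subvf.
case: (ex_maxnP Q0 Qm) => d /asboolP [U dU UP] dm; exists U => v.
split=> [/UP //|Pv]; rewrite memvE.
have /eqP -> : U == (U + <[v]>)%VS.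
  rewrite eqEdim addvSl dU dm //; apply/asboolP; exists (U + <[v]>)%VS => // w.
  by move=> /memv_addP [u /UP Pu [_ /vlineP [c ->] ->]]; rewrite addrC; exact: PD.
exact: addvSr.
Qed.

(** The component [I_k] as a vector space; for a homogeneous ideal the default value does not occur,
    by [mem_hcomp]. *)
Definition hcomp I k : {vspace Sk k} :=
  xget 0%VS [set U : {vspace Sk k} | forall v, v \in U <-> I (mpoly_of_dhomog v)].

Definition hdim I k : nat := \dim (hcomp I k).

Lemma mem_hcomp I k (v : Sk k) : homog_ideal I -> v \in hcomp I k <-> I (mpoly_of_dhomog v).
Proof.
move=> hI; rewrite /hcomp; case: xgetP => [U _ //|nU]; exfalso.
have [|c u w Iu Iw|U hU] := @exists_vspace _ (fun v : Sk k => I (mpoly_of_dhomog v)).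
- exact: hideal0.
- by rewrite raddfD /=; apply: (hidealD hI) => //; exact: hidealZ.
- exact: nU hU.
Qed.

Lemma eq_hdim I J k : (forall p, p \is k.-homog -> I p <-> J p) -> hdim I k = hdim J k.
Proof.
move=> IJ; rewrite /hdim /hcomp; congr (\dim (xget _ _)).
by apply/seteqP; split=> U /= hU v; rewrite hU; [|symmetry]; apply: IJ;
  exact: dhomog_is_dhomog.
Qed.

Lemma hdim_full I k : homog_ideal I ->
  (hdim I k = \dim {:Sk k}) <-> (forall p, p \is k.-homog -> I p).
Proof.
move=> hI; split=> [h p hp|h].
  have /eqP hf : hcomp I k == fullv by rewrite eqEdim subvf -/(hdim I k) h /=.
  by have := memvf (DHomog hp); rewrite -hf mem_hcomp.
suff hf : hcomp I k = fullv by rewrite /hdim hf.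
apply/vspaceP => v; rewrite memvf; apply/mem_hcomp => //.
by apply: h; exact: dhomog_is_dhomog.
Qed.

Lemma hdimS_eq I J k : homog_ideal I -> homog_ideal J -> I `<=` J ->
  hdim I k = hdim J k -> forall p, p \is k.-homog -> J p -> I p.
Proof.
move=> hI hJ IJ h p hp Jp.
have /eqP hf : hcomp I k == hcomp J k.
  rewrite eqEdim -/(hdim I k) -/(hdim J k) h leqnn andbT.
  by apply/subvP => v; rewrite !mem_hcomp // => /IJ.
by have : DHomog hp \in hcomp I k; [rewrite hf|]; rewrite mem_hcomp.
Qed.

(* The degree [k'] component of [p * a]; it is [p * a] when [a] has degree [k' - k]. *)
Definition hmul a k k' (p : Sk k) : Sk k' :=
  DHomog (pihomogP mdeg k' (mpoly_of_dhomog p * a)).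

Lemma hmul_is_linear a k k' : linear (@hmul a k k').
Proof.
move=> c p q; apply: val_inj => /=.
by rewrite mulrDl raddfD /= -scalerAl linearZ.
Qed.
HB.instance Definition _ a k k' :=
  GRing.isLinear.Build K (Sk k) (Sk k') _ (@hmul a k k') (@hmul_is_linear a k k').

Lemma hmulE a e k k' (p : Sk k) : a \is e.-homog -> (k + e)%N = k' ->
  mpoly_of_dhomog (@hmul a k k' p) = mpoly_of_dhomog p * a.
Proof.
move=> ha <- /=; rewrite pihomog_dE //; apply: dhomogM => //; exact: dhomog_is_dhomog.
Qed.

Lemma dim_lpreim (V W : vectType K) (f : 'Hom(V, W)) (U : {vspace W}) :
  (\dim (U + limg f) + \dim (f @^-1: U) = \dim U + \dim {:V})%N.
Proof.
have h1 := limg_ker_dim f (f @^-1: U); have h2 := limg_ker_dim f fullv.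
have h3 := dimv_sum_cap U (limg f).
have hk : (lker f <= f @^-1: U)%VS by rewrite -lpreim0 lpreimS ?sub0v.
have hi : (f @: (f @^-1: U))%VS = (U :&: limg f)%VS.
  by rewrite -lpreim_cap_limg lpreimK ?capvSr.
rewrite (capv_idPr hk) hi in h1; rewrite capfv in h2.
move: h1 h2 h3; lia.
Qed.

(** Rank formula for multiplication by [a] on degree [k]: [I] plus the image is [adj I a], and the
    preimage of [I] is [colon I a]. *)
Lemma hdim_adj I e a k : homog_ideal I -> a \is e.-homog ->
  (hdim (adj I a) (k + e) + hdim (colon I a) k = hdim I (k + e) + \dim {:Sk k})%N.
Proof.
move=> hI ha; have hIa := adj_hideal hI ha; have hC := colon_hideal hI ha.
pose f := linfun (@hmul a k (k + e)).
have fE (v : Sk k) : mpoly_of_dhomog (f v) = mpoly_of_dhomog v * a.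
  by rewrite lfunE /=; exact: (hmulE _ ha).
rewrite -(dim_lpreim f (hcomp I (k + e))); rewrite /hdim; congr (_ + _)%N; congr (\dim _).
- apply/vspaceP => v; apply/idP/idP.
    rewrite mem_hcomp // => /(adj_homogP hI ha (dhomog_is_dhomog v)) [q].
    rewrite addnK => hq Iq; rewrite -(subrK (f (DHomog hq)) v); apply: memv_add.
      by apply/mem_hcomp => //; rewrite raddfB /= fE.
    exact: memv_img (memvf _).
  move=> /memv_addP [u /mem_hcomp -/(_ hI) Iu [_ /memv_imgP [w _ ->] ->]].
  apply/mem_hcomp => //; rewrite raddfD /= fE; apply: (hidealD hIa).
    exact: sub_adj.
  exact: adj_gen.
- apply/vspaceP => v; rewrite -memv_preim; apply/idP/idP.
    by move=> /mem_hcomp -/(_ hC) h; apply/mem_hcomp; rewrite ?fE.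
  by move=> /mem_hcomp -/(_ hI); rewrite fE => h; apply/mem_hcomp.
Qed.

Lemma hdim_adj_lt I e a k : homog_ideal I -> a \is e.-homog -> (k < e)%N ->
  hdim (adj I a) k = hdim I k.
Proof.
move=> hI ha ke; apply: eq_hdim => p hp; split=> [|Ip]; last exact: sub_adj.
exact: (adj_lt hI ha hp ke).
Qed.

Lemma hdim_adj_regular I e a k : homog_ideal I -> a \is e.-homog ->
  regular_mod I a ->
  (hdim (adj I a) (k + e) + hdim I k = hdim I (k + e) + \dim {:Sk k})%N.
Proof.
move=> hI ha ra; rewrite -(hdim_adj _ hI ha); congr (_ + _)%N.
by apply: eq_hdim => p _; split=> [|/ra //]; exact: hidealMr.
Qed.

(** Converse of [hdim_adj_regular] in one degree: the equation forces [colon I a] and its subset [I]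
    to have the same dimension in degree [k]. *)
Lemma hdim_adj_colon I e a k : homog_ideal I -> a \is e.-homog ->
  (hdim (adj I a) (k + e) + hdim I k = hdim I (k + e) + \dim {:Sk k})%N ->
  forall p, p \is k.-homog -> I (p * a) -> I p.
Proof.
move=> hI ha; rewrite -(hdim_adj _ hI ha) => /addnI h p hp Ipa.
apply: (@hdimS_eq I (colon I a) k hI (colon_hideal hI ha)) => //.
by move=> q; exact: hidealMr.
Qed.

Lemma hdim_adj_colon_eq I J e a b k : homog_ideal I -> homog_ideal J ->
  a \is e.-homog -> b \is e.-homog -> regular_mod J b ->
  (forall j, hdim I j = hdim J j) ->
  hdim (adj I a) (k + e) = hdim (adj J b) (k + e) ->
  forall p, p \is k.-homog -> I (p * a) -> I p.
Proof.
move=> hI hJ ha hb rb IJ E; apply: (hdim_adj_colon hI ha).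
by rewrite E !IJ; exact: hdim_adj_regular hb rb.
Qed.

(** Adjoining a regular form of degree [e] changes the Hilbert function by a rule that involves only
    [e]; below degree [e] nothing changes. *)
Lemma hdim_regular_seq I J e s t : homog_ideal I -> homog_ideal J ->
  size s = size t ->
  {in s, forall u, u \is e.-homog} -> {in t, forall u, u \is e.-homog} ->
  regular_seq I s -> regular_seq J t ->
  (forall k, hdim I k = hdim J k) ->
  forall k, hdim (adjs I s) k = hdim (adjs J t) k.
Proof.
elim: s t I J => [|a s IH] [|b t] I J // hI hJ [st] hs ht /= [ra rs] [rb rt] IJ.
have ha : a \is e.-homog by apply: hs; rewrite mem_head.
have hb : b \is e.-homog by apply: ht; rewrite mem_head.
apply: IH => //.
- exact: adj_hideal ha.
- exact: adj_hideal hb.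
- by move=> u us; apply: hs; rewrite inE us orbT.
- by move=> u us; apply: ht; rewrite inE us orbT.
move=> k; case: (ltnP k e) => ke; first by rewrite !(hdim_adj_lt _ _ ke).
have := hdim_adj_regular (k - e) hI ha ra.
have := hdim_adj_regular (k - e) hJ hb rb.
by rewrite subnK // -!IJ => <- /addIn.
Qed.

End HilbertFunction.

(** * The model complete intersection given by the powers [x_i ^ e] *)

Section Fermat.
Variables (K : fieldType) (n : nat).
Local Notation S := {mpoly K[n.+1]}.

Definition powers e (r : seq 'I_n.+1) : seq S := [seq 'X_i ^+ e | i <- r].

Lemma powers_homog e r : {in powers e r, forall u, u \is e.-homog}.
Proof.
move=> _ /mapP [i _ ->]; apply: linear_form_powX; exact: X_homog.
Qed.

Lemma mem_powers e r p : adjs [set 0] (powers e r) p <->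
  forall m, m \in msupp p -> has (fun i => e <= m i)%N r.
Proof.
have hP := adjs_hideal (homog_ideal0 K n) (@powers_homog e r).
split; last first.
  move=> h; rewrite (mpolyE p) big_seq_cond.
  apply: (hideal_sum hP) => m; rewrite andbT => /h /hasP [i ir em].
  have -> : m = (m - U_(i) *+ e + U_(i) *+ e)%MM.
    rewrite submK //; apply/mnm_lepP => j; rewrite mulmnE mnm1E.
    by case: eqP => [<-|_]; rewrite ?mul1n.
  rewrite mpolyXD scalerAl -mpolyXn; apply: (hidealM hP).
  apply: (adjs_gen (homog_ideal0 K n)).
  exact: map_f.
pose A : set S := [set q | forall m, m \in msupp q -> has (fun i => e <= m i)%N r].
suff hA : homog_ideal A.
  apply: (adjs_min (J := A)) => // [_ ->|_ /mapP [i ir ->]] m.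
    by rewrite msupp0.
  rewrite mpolyXn => /mem_msuppXP <-; apply/hasP; exists i => //.
  by rewrite mulmnE mnm1E eqxx mul1n.
split.
- by move=> m; rewrite msupp0.
- by move=> f g hf hg m /msuppD_le; rewrite mem_cat => /orP [/hf|/hg].
- move=> f g hg m /msuppM_le /allpairsP [[m1 m2] /= [_ /hg /hasP [i ir em] ->]].
  by apply/hasP; exists i => //; rewrite mnmDE; apply: leq_trans em (leq_addl _ _).
- move=> k f hf m; rewrite mcoeff_msupp pihomogE raddf_sum /= => nz; apply: hf.
  rewrite mcoeff_msupp; apply: contra nz => /eqP f0.
  rewrite big_seq_cond big1 // => m' _; rewrite mcoeffZ mcoeffX.
  by case: eqP => [->|_]; rewrite ?f0 ?mul0r ?mulr0.
Qed.

(** Multiplication by ['X_i ^+ e] only shifts the exponent of ['X_i], and membership in the ideal of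
    the other powers does not see that exponent. *)
Lemma powers_regular e r : uniq r -> regular_seq [set 0] (powers e r).
Proof.
elim/last_ind: r => [|r i IH] //; rewrite rcons_uniq => /andP [ir /IH hr].
rewrite /powers map_rcons; apply/regular_seq_rcons; split=> // p.
rewrite -/(powers e r) mpolyXn => /mem_powers h; apply/mem_powers => m mp.
have /h : (U_(i) *+ e + m)%MM \in msupp (p * 'X_[U_(i) *+ e]).
  by rewrite mcoeff_msupp mcoeffMX -mcoeff_msupp.
move=> /hasP [j jr em]; apply/hasP; exists j => //.
move: em; rewrite mnmDE mulmnE mnm1E; case: eqP => [E|//]; by rewrite E jr in ir.
Qed.

Lemma powers_full e k p : (0 < e)%N -> (n.+1 * e.-1 < k)%N -> p \is k.-homog ->
  adjs [set 0] (powers e (enum 'I_n.+1)) p.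
Proof.
move=> e0 ek hp; apply/mem_powers => m /(dhomog_mdeg hp) mk.
apply: contraLR ek => /hasPn hm; rewrite -leqNgt -mk mdegE.
rewrite -[X in (_ <= X * _)%N]card_ord -sum_nat_const; apply: leq_sum => i _.
by have := hm i; rewrite mem_enum -ltnNge => /(_ isT); lia.
Qed.

(** In such a degree every monomial has some exponent below [e.-1]; multiplying by that variable
    cannot bring it into the ideal. *)
Lemma powers_socle_free e k : (k < n.+1 * e.-1)%N ->
  socle_free (adjs [set 0] (powers e (enum 'I_n.+1)) : set S) k.
Proof.
move=> ke p hp h; apply/mem_powers => m mp.
have [j hj] : exists j, (m j < e.-1)%N.
  apply/existsP; apply: contraLR ke; rewrite negb_exists => /forallP hm.
  rewrite -leqNgt -(dhomog_mdeg hp mp) mdegE -[X in (X * _ <= _)%N]card_ord -sum_nat_const.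
  by apply: leq_sum => i _; rewrite leqNgt.
have /mem_powers -/(_ (U_(j) + m)%MM) := h j.
rewrite mulrC mcoeff_msupp mcoeffMX -mcoeff_msupp mp => /(_ isT) /hasP [i ir].
rewrite mnmDE mnm1E => em; apply/hasP; exists i => //.
by move: em hj; case: eqP => [->|_] //; lia.
Qed.

(** The only monomial of this degree outside the ideal is [m0], with all exponents equal to
    [e.-1]. *)
Lemma powers_codim e : (0 < e)%N -> (\dim {:dhomog n.+1 K (n.+1 * e.-1)} <=
  (hdim (adjs [set 0%R : S] (powers e (enum 'I_n.+1))) (n.+1 * e.-1)).+1)%N.
Proof.
move=> e0; set k := (n.+1 * e.-1)%N; set I := adjs _ _.
have hI : homog_ideal I := adjs_hideal (homog_ideal0 K n) (@powers_homog e _).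
pose m0 : 'X_{1..n.+1} := [multinom e.-1 | i < n.+1].
have hm0 : 'X_[K, m0] \is k.-homog.
  have -> : k = mdeg m0; last exact: mpolyX_homog.
  rewrite mdegE; under eq_bigr do rewrite mnmE.
  by rewrite sum_nat_const card_ord.
have <- : (hcomp I k + <[DHomog hm0]>)%VS = fullv.
  apply/vspaceP => v; rewrite memvf; apply/idP.
  set c := (mpoly_of_dhomog v)@_m0.
  rewrite -(subrK (c *: DHomog hm0) v); apply: memv_add; last by rewrite rpredZ ?memv_line.
  apply/mem_hcomp => //; rewrite raddfB /=; apply/mem_powers => m mv.
  apply: contraTT mv => /hasPn hm; rewrite -mcoeff_eq0.
  rewrite mcoeffB mcoeffZ mcoeffX.
  have hmi i : (m i <= e.-1)%N.
    by have := hm i; rewrite mem_enum -ltnNge => /(_ isT); lia.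
  case: (m0 =P m) => [<-|ne]; first by rewrite mulr1 subrr.
  rewrite mulr0n mulr0 subr0; apply/eqP; apply: (dhomog_nemf_coeff (dhomog_is_dhomog v)).
  apply: contra_notN ne => /eqP /esym mk; apply/mnmP => i; rewrite mnmE; apply/eqP.
  rewrite eq_sym eqn_leq hmi /=.
  have := mk : k = mdeg m; rewrite mdegE (bigD1 i) //= => {}mk.
  have h : (\sum_(j < n.+1 | j != i) m j <= n * e.-1)%N.
    rewrite -[n in leqRHS](_ : #|[pred j : 'I_n.+1 | j != i]| = n); last first.
      by rewrite cardC1 card_ord.
    by rewrite -sum_nat_const; apply: leq_sum.
  by rewrite -(leq_add2r (n * e.-1)) -mulSn -/k mk leq_add2l.
apply: leq_trans (dimv_add_leqif _ _) _; rewrite dim_vline addnC.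
by case: eqP => _; rewrite ?add0n // leqnSn.
Qed.

End Fermat.

(** * Substitution of polynomials into a polynomial *)

Section Substitution.
Variables (K : fieldType) (n m : nat).
Local Notation S := {mpoly K[n.+1]}.
Implicit Types (I : set S) (P : {mpoly K[m]}) (u v : m.-tuple S).

Lemma comp_mpoly_congr I u v P : homog_ideal I ->
  (forall i, I (tnth u i - tnth v i)) -> I ((P \mPo u) - (P \mPo v)).
Proof.
move=> hI huv; rewrite !comp_mpolyE -sumrB; apply: (hideal_sum hI) => k _.
rewrite -scalerBr; apply: (hidealZ hI).
have hM (a b c d : S) : I (a - b) -> I (c - d) -> I (a * c - b * d).
  move=> hab hcd; have -> : a * c - b * d = c * (a - b) + b * (c - d) by ring.
  by apply: (hidealD hI); apply: hidealM.
apply: (big_ind2 (fun a b => I (a - b))) => // [|i _].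
  by rewrite subrr; exact: hideal0.
elim: (k i) => [|j IH]; first by rewrite !expr0 subrr; exact: hideal0.
by rewrite !exprS; exact: hM.
Qed.

Lemma comp_mpoly_scale k P (c : 'I_m -> K) (a : S) : P \is k.-homog ->
  P \mPo [tuple c i *: a | i < m] = P.@[c] *: a ^+ k.
Proof.
move=> hP; rewrite comp_mpolyE mevalE scaler_suml big_seq_cond [RHS]big_seq_cond.
apply: eq_bigr => j; rewrite andbT => /(dhomog_mdeg hP) <-.
rewrite -scalerA; congr (_ *: _).
under [LHS]eq_bigr do rewrite tnth_mktuple exprZn.
by rewrite scaler_prod mdegE prodrXr.
Qed.

Lemma comp_mpoly_homog k e P u : P \is k.-homog ->
  (forall i, tnth u i \is e.-homog) -> P \mPo u \is (e * k).-homog.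
Proof.
move=> hP hu; rewrite comp_mpolyE big_seq_cond; apply: rpred_sum => j.
rewrite andbT => /(dhomog_mdeg hP) <-; apply: rpredZ; rewrite mdegE big_distrr /=.
elim/big_rec2: _ => [|i p q _ h]; first exact: dhomog1.
by apply: dhomogM => //; apply: dhomogMn.
Qed.

End Substitution.

(** * The projective Nullstellensatz *)

Section Nullstellensatz.
Variables (K : closedFieldType) (n : nat).
Local Notation S := {mpoly K[n.+1]}.
Implicit Types (I J M : set S) (p q a b : S).

Lemma powers_colength I e : homog_ideal I -> (0 < e)%N ->
  (forall i, I ('X_i ^+ e)) -> finite_colength I.
Proof.
move=> hI e0 h; exists (n.+1 * e.-1).+1 => p /(powers_full e0) hp.
apply: (adjs_min hI _ _ (hp _)) => // [_ ->|_ /mapP [i _ ->]]; last exact: h.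
exact: hideal0.
Qed.

(** Finite colength is witnessed by one power of each variable, and a single member of the chain
    contains these finitely many elements. *)
Lemma finite_colength_bigcup (F : set (set S)) I : homog_ideal I ->
  total_on F subset -> F !=set0 -> (forall X, F X -> homog_ideal (I `|` X)) ->
  homog_ideal (I `|` \bigcup_(X in F) X) /\
  (finite_colength (I `|` \bigcup_(X in F) X) ->
     exists2 X, F X & finite_colength (I `|` X)).
Proof.
move=> hI Ft [X0 FX0] FI; set U := I `|` _.
have UP p : U p -> exists2 X, F X & (I `|` X) p.
  by move=> [Ip|[X FX Xp]]; [exists X0 => //; left|exists X => //; right].
have UF X : F X -> (I `|` X) `<=` U.
  by move=> FX; apply: setUS; exact: bigcup_sup.
have F2 X Y : F X -> F Y -> exists2 Z, F Z & (X `<=` Z) /\ (Y `<=` Z).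
  by move=> FX FY; case: (Ft _ _ FX FY) => h; [exists Y => //; split|exists X => //; split].
have hU : homog_ideal U.
  split.
  - by left; exact: hideal0.
  - move=> p q /UP [X FX Xp] /UP [Y FY Yq].
    have [Z FZ [XZ YZ]] := F2 _ _ FX FY.
    apply: (UF Z FZ); apply: (hidealD (FI Z FZ)).
      exact: setUS XZ _ Xp.
    exact: setUS YZ _ Yq.
  - by move=> p q /UP [X FX Xq]; apply: (UF X FX); exact: (hidealM (FI X FX)).
  - by move=> k p /UP [X FX Xp]; apply: (UF X FX); exact: (hideal_pihomog (FI X FX)).
split=> // -[N hN].
have [X FX hX] : exists2 X, F X & forall i, i \in enum 'I_n.+1 -> (I `|` X) ('X_i ^+ N.+1).
  elim: (enum _) => [|i r [X FX hX]]; first by exists X0.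
  have [Y FY Yi] : exists2 Y, F Y & (I `|` Y) ('X_i ^+ N.+1).
    by apply: UP; rewrite exprS; apply: (hidealM hU); apply: hN;
      apply: (@powers_homog _ _ _ [:: i]); rewrite mem_head.
  have [Z FZ [XZ YZ]] := F2 _ _ FX FY.
  exists Z => // j; rewrite inE => /predU1P [->|/hX]; first exact: setUS YZ _ Yi.
  exact: setUS XZ _.
exists X => //; apply: (@powers_colength _ N.+1) => // [|i]; first exact: FI.
by apply: hX; rewrite mem_enum.
Qed.

(** Zorn's lemma, applied to the sets [X] whose union with [I] is a homogeneous ideal of infinite
    colength; with the union, the empty chain is bounded by [I] itself. *)
Lemma exists_maximal_ideal I : homog_ideal I -> ~ finite_colength I ->
  exists M, [/\ homog_ideal M, I `<=` M, ~ finite_colength M &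
    forall e a, a \is e.-homog -> ~ M a -> finite_colength (adj M a)].
Proof.
move=> hI nI.
pose P X := homog_ideal (I `|` X) /\ ~ finite_colength (I `|` X).
have [F FP Ft|M [[hM nM] mM]] := @Zorn_bigcup _ P.
  have [[X0 FX0]|F0] := pselect (F !=set0); last first.
    have -> : F = set0 by apply/seteqP; split=> // X FX; case: F0; exists X.
    by rewrite /P bigcup_set0 setU0.
  have [|X FX|hU fU] := @finite_colength_bigcup F I hI Ft.
  - by exists X0.
  - by have [] := FP _ FX.
  - by split=> // /fU [X /FP []].
exists (I `|` M); split=> // e a ha na.
apply: contrapT => nf; apply: (mM (adj (I `|` M) a)).
  split; first by move=> p Mp; apply: sub_adj; right.
  move=> /(_ a) h; apply: na; right; apply: h.
  by rewrite -[a in X in _ X]mul1r; exact: adj_gen.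
rewrite /P; have -> : I `|` adj (I `|` M) a = adj (I `|` M) a.
  by apply: setUidr => p Ip; apply: sub_adj; left.
by split=> //; exact: adj_hideal ha.
Qed.

Section Maximal.
Variables (M : set S) (hM : homog_ideal M) (nM : ~ finite_colength M).
Hypothesis maxM :
  forall e a, a \is e.-homog -> ~ M a -> finite_colength (adj M a).

(** If neither factor is in [M], a form of large degree is a multiple of [a] modulo [M], the
    cofactor is a multiple of [b], and the form is in [M]. *)
Lemma maximal_prime d e a b : a \is d.-homog -> b \is e.-homog ->
  M (a * b) -> M a \/ M b.
Proof.
move=> ha hb Mab; apply: contrapT => /not_orP [na nb]; apply: nM.
have [N1 h1] := finite_colengthP (adj_hideal hM ha) (maxM ha na).
have [N2 h2] := finite_colengthP (adj_hideal hM hb) (maxM hb nb).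
exists (N1 + N2 + d)%N => p hp.
have [|q hq Mq] := adj_homogP hM ha hp; first by apply: h1 hp; lia.
have [|r hr Mr] := adj_homogP hM hb hq; first by apply: h2 hq; lia.
apply: (hidealBr hM _ Mq).
have -> : q * a = (q - r * b) * a + r * (a * b) by ring.
by apply: (hidealD hM); [apply: hidealMr|apply: hidealM].
Qed.

Lemma maximal_primeX d a k : a \is d.-homog -> M (a ^+ k) -> M a.
Proof.
move=> ha; elim: k => [|k IH]; last first.
  by rewrite exprS => /(maximal_prime ha (dhomogMn k ha)) [|/IH].
by rewrite expr0 => /(hidealM hM a); rewrite mulr1.
Qed.

Lemma monom2_homog (i j : 'I_n.+1) k t : (t <= k)%N ->
  ('X_j ^+ t * 'X_i ^+ (k - t) : S) \is k.-homog.
Proof.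
move=> tk; have := dhomogM (dhomogMn t (X_homog K j)) (dhomogMn (k - t) (X_homog K i)).
by rewrite !mul1n subnKC.
Qed.

(** The binary form [a ^ k * P (b / a)]. *)
Definition homogenize k (P : {poly K}) a b : S :=
  \sum_(t < k.+1) P`_t *: (b ^+ t * a ^+ (k - t)).

Lemma homogenize_factor k (P : {poly K}) r a b : (size P <= k.+1)%N ->
  homogenize k.+1 (P * ('X - r%:P)) a b = homogenize k P a b * (b - r *: a).
Proof.
move=> sP; rewrite /homogenize [RHS]mulrBr mulrBr.
under [LHS]eq_bigr do rewrite coefB coefMX coefMC scalerBl.
rewrite sumrB; congr (_ - _).
  rewrite big_ord_recl /= scale0r add0r mulr_suml; apply: eq_bigr => t _.
  by rewrite -scalerAl /= subSS; congr (_ *: _); rewrite mulrAC -exprSr.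
rewrite big_ord_recr /= nth_default // mul0r scale0r addr0 mulr_suml.
apply: eq_bigr => t _; rewrite -scalerAl -scalerAr scalerA; congr (_ *: _).
by rewrite -mulrA -exprSr subSn // -ltnS.
Qed.

(** Over a closed field each root splits off a linear form, and [M] is prime; a constant [P] would
    put a power of ['X_i] in [M]. *)
Lemma homogenize_root k (P : {poly K}) (i j : 'I_n.+1) : ~ M 'X_i -> P != 0 ->
  (size P <= k.+1)%N -> M (homogenize k P 'X_i 'X_j) ->
  exists r, M ('X_j - r *: 'X_i).
Proof.
move=> ni; elim: k P => [|k IH] P P0 sP.
  rewrite /homogenize big_ord1 subnn !expr0 mulr1 => /(hidealZK hM).
  move=> h; exfalso; apply: ni; rewrite -['X_i]mulr1; apply: (hidealM hM); apply: h.
  by move: P0; rewrite (size1_polyC sP) polyC_eq0 coefC.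
have [sP1|sP1] := eqVneq (size P) 1%N.
  have [c c0 Pc] : exists2 c, c != 0 & P = c%:P by apply/size_poly1P; rewrite sP1.
  rewrite /homogenize Pc big_ord_recl coefC /= big1 ?addr0 => [|t _].
    move=> /(hidealZK hM c0); rewrite expr0 mul1r => /(maximal_primeX (X_homog K i)).
    by move=> /ni.
  by rewrite coefC /= scale0r.
have /closed_rootP [r /factor_theorem [Q PQ]] := sP1.
have Q0 : Q != 0 by apply: contraNneq P0 => Q0; rewrite PQ Q0 mul0r.
have sQ : (size Q <= k.+1)%N.
  by move: sP; rewrite PQ size_Mmonic ?monicXsubC // size_XsubC addn2.
rewrite PQ homogenize_factor // => hh.
have hX : 'X_j - r *: 'X_i \is [in K[n.+1], 1.-homog].
  by apply: rpredB; [|apply: rpredZ]; exact: X_homog.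
have hk : homogenize k Q 'X_i 'X_j \is k.-homog.
  by apply: rpred_sum => t _; apply/rpredZ/monom2_homog; rewrite -ltnS.
by have [/(IH Q Q0 sQ)|] := maximal_prime hk hX hh; last by exists r.
Qed.

(* The forms [x_i^(k-t) x_j^t] of large degree [k] are linearly dependent modulo [M],
   as multiplication by a power of [x_i] is onto in large degrees; the dependence
   factors into linear forms. *)
Lemma maximal_linear (i j : 'I_n.+1) : ~ M 'X_i ->
  exists r, M ('X_j - r *: 'X_i).
Proof.
move=> ni; have hXi := X_homog K i.
have [N hN] := finite_colengthP (adj_hideal hM hXi) (maxM hXi ni).
have red r p : p \is (N + r).-homog -> exists2 s, s \is N.-homog & M (p - s * 'X_i ^+ r).
  elim: r p => [|r IH] p; rewrite ?addn0 ?addnS.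
    by move=> hp; exists p; rewrite // expr0 mulr1 subrr; exact: hideal0.
  move=> hp; have [|q] := adj_homogP hM hXi hp; first by apply: hN hp; lia.
  rewrite subn1 => /IH [s hs Ms] Mq; exists s => //.
  have -> : p - s * 'X_i ^+ r.+1 = (p - q * 'X_i) + (q - s * 'X_i ^+ r) * 'X_i.
    by rewrite exprSr; ring.
  by apply: (hidealD hM) => //; exact: hidealMr.
(* There are [k.+1 > r] monomials of degree [k] in ['X_i] and ['X_j], and their reductions lie in a
   space of dimension [r]. *)
set r := \dim {:dhomog n.+1 K N}; pose k := (N + r)%N.
have hmon (t : 'I_k.+1) : 'X_j ^+ t * 'X_i ^+ (k - t) \is [in K[n.+1], k.-homog].
  by apply: monom2_homog; rewrite -ltnS.
have hs (t : 'I_k.+1) : exists s : dhomog n.+1 K N,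
    M ('X_j ^+ t * 'X_i ^+ (k - t) - mpoly_of_dhomog s * 'X_i ^+ r).
  by have [s ss Ms] := red r _ (hmon t); exists (DHomog ss).
have [s sP] := choice hs.
have [c cs [t0 ct0]] : exists2 c : 'I_k.+1 -> K, \sum_t c t *: s t = 0 &
    exists t, c t != 0.
  have : ~~ free [tuple s t | t < k.+1].
    rewrite /free neq_ltn size_tuple.
    by rewrite (leq_ltn_trans (dimvS (subvf _))) // ltnS leq_addl.
  move=> /freeP nf; apply: contrapT => nc; apply: nf => c h t.
  apply: contrapT => /eqP ct; apply: nc; exists c; last by exists t.
  by rewrite -[RHS]h; apply: eq_bigr => t' _; rewrite -tnth_nth tnth_mktuple.
pose P := \poly_(t < k.+1) c (inord t).
apply: (@homogenize_root k P) => //.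
- apply: contraNneq ct0 => P0; have := congr1 (fun Q : {poly K} => Q`_t0) P0.
  by rewrite coef_poly ltn_ord coef0 inord_val => ->.
- exact: size_poly.
have -> : homogenize k P 'X_i 'X_j =
    \sum_(t < k.+1)
      c t *: ('X_j ^+ t * 'X_i ^+ (k - t) - mpoly_of_dhomog (s t) * 'X_i ^+ r).
  under [RHS]eq_bigr do rewrite scalerBr [X in _ - X]scalerAl.
  rewrite sumrB -mulr_suml.
  have -> : \sum_t c t *: mpoly_of_dhomog (s t) = mpoly_of_dhomog (\sum_t c t *: s t).
    by rewrite raddf_sum.
  rewrite cs raddf0 mul0r subr0; apply: eq_bigr => t _.
  by rewrite coef_poly ltn_ord inord_val.
by apply: (hideal_sum hM) => t _; apply: (hidealZ hM).
Qed.

End Maximal.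

(** Modulo a maximal [M] every variable is a multiple of one ['X_i], so a form [p] of degree [k] in
    [M] is congruent to its value at the point times ['X_i ^+ k], and no power of ['X_i] is in
    [M]. *)
Lemma projective_nullstellensatz I : homog_ideal I -> ~ finite_colength I ->
  exists2 v : 'rV[K]_n.+1, proj_space v &
    forall k p, p \is k.-homog -> I p -> p.@[v 0] = 0.
Proof.
move=> hI /(exists_maximal_ideal hI) [M [hM IM nM maxM]].
(* Taking the least such index makes the earlier coordinates vanish, as the normalization in
   [proj_space] demands. *)
have [k Pk mk] : exists2 k, (exists2 i : 'I_n.+1, i = k :> nat & ~ M 'X_i) &
    forall i : 'I_n.+1, (i < k)%N -> M 'X_i.
  pose P k := `[< exists2 i : 'I_n.+1, i = k :> nat & ~ M 'X_i >].
  have exP : exists k, P k.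
    apply: contrapT => h; apply: nM; apply: (@powers_colength _ 1) => // i.
    rewrite expr1; apply: contrapT => ni; apply: h; exists i; apply/asboolP.
    by exists i.
  case: (ex_minnP exP) => k /asboolP Pk mk; exists k => // i ik.
  apply: contrapT => ni; have : P i by apply/asboolP; exists i.
  by move=> /mk; rewrite leqNgt ik.
case: Pk => i ik ni; rewrite -{k}ik in mk.
have hr j : exists r, [/\ M ('X_j - r *: 'X_i), j = i -> r = 1 & (j < i)%N -> r = 0].
  have [ji|ji|/val_inj ->] := ltngtP j i.
  - exists 0; rewrite scale0r subr0; split=> // [|E]; first exact: mk.
    by rewrite E ltnn in ji.
  - have [r Mr] := maximal_linear hM nM maxM j ni; exists r; split=> // E.
    by rewrite E ltnn in ji.
  - by exists 1; rewrite scale1r subrr; split=> //; exact: hideal0.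
have [r rP] := choice hr.
exists (\row_j r j).
  exists i; rewrite mxE; split; first by have [_ ->] := rP i.
  by move=> j ji; rewrite mxE; have [_ _ ->] := rP j.
move=> k p hp /IM Mp.
have : M ((p \mPo [tuple 'X_j | j < n.+1]) - (p \mPo [tuple r j *: 'X_i | j < n.+1])).
  apply: (comp_mpoly_congr _ hM) => j; rewrite !tnth_mktuple.
  by have [] := rP j.
rewrite comp_mpoly_id (comp_mpoly_scale _ _ hp) => h.
have {h} : M (p.@[r] *: 'X_i ^+ k).
  by rewrite -(subKr p (_ *: _)); exact: hidealB.
have -> : p.@[(\row_j r j) 0] = p.@[r] by apply: meval_eq => j; rewrite mxE.
have [//|nz] := eqVneq p.@[r] 0 => /(hidealZK hM nz).
by move=> /(maximal_primeX hM nM maxM (X_homog K i)) /ni.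
Qed.

End Nullstellensatz.

(** * Radicals, points of nonvanishing and a binomial estimate, used to choose coordinates *)

Section Reduction.
Variables (K : fieldType) (n : nat).
Local Notation S := {mpoly K[n.+1]}.
Implicit Types (I J : set S) (p q a b : S).

(** In large degree a form can be divided by [a] modulo [I] again and again, until the factor
    [a ^+ N] appears. *)
Lemma finite_colength_radical I e a N : homog_ideal I -> a \is e.-homog ->
  I (a ^+ N) -> finite_colength (adj I a) -> finite_colength I.
Proof.
move=> hI ha IaN /(finite_colengthP (adj_hideal hI ha)) [M hM].
suff h j p : p \is (M + j * e).-homog -> exists q, I (p - q * a ^+ j).
  exists (M + N * e)%N => p /h [q Iq]; apply: (hidealBr hI _ Iq).
  exact: hidealM.
elim: j p => [|j IH] p hp; first by exists p; rewrite expr0 mulr1 subrr; exact: hideal0.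
have [|q hq Iq] := adj_homogP hI ha hp; first by apply: hM hp; rewrite leq_addr.
have [|r Ir] := IH q; first by move: hq; rewrite mulSn addnCA addKn.
exists r; have -> : p - r * a ^+ j.+1 = (p - q * a) + (q - r * a ^+ j) * a.
  by rewrite exprSr; ring.
by apply: (hidealD hI) => //; exact: hidealMr.
Qed.

Lemma regular_mod0 a : a != 0 -> regular_mod [set 0] a.
Proof. by move=> a0 p /= /eqP; rewrite mulf_eq0 (negbTE a0) orbF => /eqP. Qed.

End Reduction.

Section NonVanishing.

Lemma base_expansion_inj B k (a b : nat -> nat) :
  (forall i, a i < B)%N -> (forall i, b i < B)%N ->
  (\sum_(i < k) a i * B ^ i = \sum_(i < k) b i * B ^ i)%N ->
  forall i, (i < k)%N -> a i = b i.
Proof.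
elim: k a b => [|k IH] a b aB bB //.
have hs (u : nat -> nat) : (\sum_(i < k.+1) u i * B ^ i =
    (\sum_(i < k) u i.+1 * B ^ i) * B + u 0)%N.
  rewrite big_ord_recl expn0 muln1 addnC big_distrl /=; congr (_ + _)%N.
  by apply: eq_bigr => i _; rewrite /bump /= add1n expnSr mulnA.
rewrite !hs => E; have B0 : (0 < B)%N := leq_ltn_trans (leq0n _) (aB 0%N).
have E0 : a 0%N = b 0%N.
  by have := congr1 (modn^~ B) E; rewrite !modnMDl !modn_small.
move=> [|i] // ik; apply: (IH (a \o S) (b \o S)) => //=.
by move/eqP: E; rewrite E0 eqn_add2r eqn_pmul2r // => /eqP.
Qed.

(* The substitution [c_i = t ^ (B ^ i)] sends distinct monomials to distinct powers of [t]. *)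
Lemma exists_nonvanishing (K : numFieldType) n (p : {mpoly K[n]}) : p != 0 ->
  exists c : 'I_n -> K, (forall i, c i != 0) /\ p.@[c] != 0.
Proof.
move=> p0; pose B := msize p.
pose w (m : 'X_{1..n}) := (\sum_(i < n) m i * B ^ i)%N.
pose Q : {poly K} := \sum_(m <- msupp p) p@_m *: 'X^(w m).
have mB (m : 'X_{1..n}) i : m \in msupp p -> (m i < B)%N.
  move=> /msize_mdeg_lt; apply: leq_ltn_trans.
  by rewrite mdegE (bigD1 i) //= leq_addr.
have w_inj m m' : m \in msupp p -> m' \in msupp p -> w m = w m' -> m = m'.
  move=> hm hm' E.
  pose ext (u : 'X_{1..n}) (i : nat) := if insub i is Some j then u j else 0%N.
  have extE (u : 'X_{1..n}) (i : 'I_n) : ext u i = u i.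
    by rewrite /ext valK.
  have extB (u : 'X_{1..n}) i : u \in msupp p -> (ext u i < B)%N.
    move=> hu; rewrite /ext; case: insubP => [j _ _|_]; first exact: mB.
    exact: leq_ltn_trans (leq0n _) (msize_mdeg_lt hu).
  have Ew (u : 'X_{1..n}) : w u = (\sum_(i < n) ext u i * B ^ i)%N.
    by apply: eq_bigr => i _; rewrite extE.
  rewrite !Ew in E; apply/mnmP => i; rewrite -!extE.
  by apply: (base_expansion_inj _ _ E) => // j; exact: extB.
have Q0 : Q != 0.
  have mp := mlead_supp p0; apply: contraNneq p0 => Q0; rewrite -mleadc_eq0.
  have := congr1 (fun R : {poly K} => R`_(w (mlead p))) Q0.
  rewrite coef0 /Q coef_sum (bigD1_seq (mlead p)) //= coefZ coefXn eqxx mulr1.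
  rewrite big_seq_cond big1 ?addr0 => [->//|m /andP [hm ne]].
  rewrite coefZ coefXn; case: eqP => [/(w_inj _ _ mp hm) E|_]; last by rewrite mulr0.
  by rewrite E eqxx in ne.
(* The factor ['X] keeps [t] nonzero, hence all the coordinates. *)
have [|t] := @exists_nonroot _ ('X * Q); first by rewrite mulf_neq0 ?polyX_eq0.
rewrite hornerM hornerX mulf_eq0 negb_or => /andP [t0 Qt].
exists (fun i => t ^+ (B ^ i)); split=> [i|]; first by rewrite expf_neq0.
suff -> : p.@[fun i => t ^+ (B ^ i)] = Q.[t] by [].
rewrite mevalE /Q horner_sum; apply: eq_bigr => m _; rewrite hornerZ hornerXn.
congr (_ * _); rewrite /w -prodrXr; apply: eq_bigr => i _.
by rewrite -exprM mulnC.
Qed.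

End NonVanishing.

(** Factor by factor, [e * N + i <= e * (N + i)]. *)
Lemma bin_scale_le e N m : (0 < e)%N -> ('C(e * N + m, m) <= e ^ m * 'C(N + m, m))%N.
Proof.
move=> e0; elim: m => [|m IH]; first by rewrite !bin0.
rewrite -(leq_pmul2l (ltn0Sn m)) mulnCA !addnS -!mul_bin_diag /= expnS.
by rewrite mulnACA; apply: leq_mul IH; nia.
Qed.

(** The number of monomials of degree [N] in [n.+1] variables grows like [N ^ n], while forms of
    degree [e * N] modulo a linear form only grow like [N ^ n.-1]. *)
Lemma exists_bin_gt e n : (0 < e)%N -> exists2 N, (0 < N)%N &
  ('C(e * N + n, e * N) < 'C(N + n, N) + 'C((e * N).-1 + n, (e * N).-1))%N.
Proof.
move=> e0; case: n => [|m].
  by exists 1%N => //; rewrite !addn0 !binn.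
exists (m.+1 * e ^ m)%N; first by rewrite muln_gt0 /= expn_gt0 e0.
(* By Pascal's rule it remains to bound ['C(e * N + m, m)] by a binomial whose ratio to
   ['C(N + m, m)] is [(N + m.+1) / m.+1]; this [N] absorbs the loss [e ^ m] of [bin_scale_le]. *)
set N := (m.+1 * e ^ m)%N; have N0 : (0 < N)%N by rewrite muln_gt0 /= expn_gt0 e0.
have eN0 : (0 < e * N)%N by rewrite muln_gt0 e0.
have bs a b : 'C(a + b, a) = 'C(a + b, b).
  by have := bin_sub (leq_addl a b); rewrite addnK.
rewrite !bs; have -> : ((e * N).-1 + m.+1 = e * N + m)%N by lia.
rewrite addnS binS addnC ltn_add2r.
have h : (m.+1 * 'C(e * N + m, m) <= N * 'C(N + m, m))%N.
  rewrite /N -mulnA; apply: leq_mul => //; exact: bin_scale_le.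
rewrite -(ltn_pmul2l (ltn0Sn m)) addnS -mul_bin_diag /=.
apply: leq_ltn_trans h _; rewrite ltn_pmul2r ?bin_gt0 ?leq_addl //; lia.
Qed.

(** * The Jacobian ideal and Euler's identity *)

Section Jacobian.
Variables (K : fieldType) (n : nat).
Local Notation S := {mpoly K[n.+1]}.
Implicit Types (f p q : S).

Definition gradient f : seq S := [seq f^`M(i) | i <- enum 'I_n.+1].

Lemma jacobian_idealE f : jacobian_ideal f = adjs [set 0] (gradient f).
Proof.
have sg : size (gradient f) = n.+1 by rewrite size_map size_enum_ord.
have ng (i : 'I_n.+1) : (gradient f)`_i = f^`M(i).
  by rewrite (nth_map ord0) ?size_enum_ord // nth_ord_enum.
apply/seteqP; split=> p.
  move=> [a _ ->]; apply/adjsP; exists (fun i => a (inord i)).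
  rewrite sg; apply/eqP; rewrite subr_eq0; apply/eqP; apply: eq_bigr => i _.
  by rewrite inord_val ng.
move=> /adjsP [q /= /eqP]; rewrite subr_eq0 sg => /eqP ->.
by exists (fun i : 'I_n.+1 => q i) => //; apply: eq_bigr => i _; rewrite ng.
Qed.

Lemma mderiv_homog d f i : f \is d.-homog -> f^`M(i) \is d.-1.-homog.
Proof.
move=> hf; rewrite /mderiv big_seq_cond; apply: rpred_sum => m.
rewrite andbT => /(dhomog_mdeg hf) dm.
have [->|mi] := eqVneq (m i) 0%N; first by rewrite mul0r scale0r dhomog0.
apply: rpredZ; rewrite -dm -(@submK _ U_(i)%MM m) ?lep1mP // mdegD mdeg1 addn1 /=.
by rewrite addmK; exact: mpolyX_homog.
Qed.

Lemma gradient_homog d f : f \is d.-homog ->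
  {in gradient f, forall u, u \is d.-1.-homog}.
Proof. by move=> hf _ /mapP [i _ ->]; exact: mderiv_homog. Qed.

Lemma euler_identity d f : f \is d.-homog -> \sum_i 'X_i * f^`M(i) = d%:R *: f.
Proof.
move=> hf; rewrite {2}(mpolyE f) scaler_sumr /mderiv.
under eq_bigr do rewrite mulr_sumr.
rewrite exchange_big /= big_seq_cond [RHS]big_seq_cond; apply: eq_bigr => m.
rewrite andbT => /(dhomog_mdeg hf) <-; rewrite mdegE natr_sum scaler_suml.
apply: eq_bigr => i _; rewrite scalerA -scalerAr.
have [->|mi] := eqVneq (m i) 0%N; first by rewrite !mul0r !scale0r.
by congr (_ *: _); rewrite mulrC -mpolyXD submK // lep1mP.
Qed.

Lemma jacobian_hideal d f : f \is d.-homog -> homog_ideal (jacobian_ideal f).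
Proof.
move=> hf; rewrite jacobian_idealE; apply: adjs_hideal (gradient_homog hf).
exact: homog_ideal0.
Qed.

Lemma jacobian_gen f i : jacobian_ideal f f^`M(i).
Proof.
rewrite jacobian_idealE; apply: adjs_gen; first exact: homog_ideal0.
by apply: map_f; rewrite mem_enum.
Qed.

Lemma meval_adjs (s : seq S) (v : 'I_n.+1 -> K) p :
  {in s, forall a, a.@[v] = 0} -> adjs [set 0] s p -> p.@[v] = 0.
Proof.
move=> hs /adjsP [q /= /eqP]; rewrite subr_eq0 => /eqP ->.
rewrite raddf_sum /= big1 // => i _.
by rewrite mevalM (hs _ (mem_nth 0 (ltn_ord i))) mulr0.
Qed.

Lemma meval_homog_scale k p (a : K) (v : 'I_n.+1 -> K) : p \is k.-homog ->
  p.@[fun i => a * v i] = a ^+ k * p.@[v].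
Proof.
move=> hp; rewrite !mevalE mulr_sumr big_seq_cond [RHS]big_seq_cond.
apply: eq_bigr => m; rewrite andbT => /(dhomog_mdeg hp) <-.
rewrite [RHS]mulrCA; congr (_ * _).
under [LHS]eq_bigr do rewrite exprMn.
by rewrite big_split /= prodrXr mdegE.
Qed.

End Jacobian.

(** * Finiteness of the singular locus and generic coordinates for the Jacobian ideal *)

Section SingularLocus.
Variables (K : numClosedFieldType) (n : nat).
Local Notation S := {mpoly K[n.+1]}.
Implicit Types (f p q : S).

Lemma sing_locusP d f (v : 'rV[K]_n.+1) : (0 < d)%N -> f \is d.-homog ->
  proj_space v -> (forall i, (f^`M(i)).@[v 0] = 0) -> sing_locus f v.
Proof.
move=> d0 hf hv h; split=> //.
have := congr1 (meval (v 0)) (euler_identity hf).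
rewrite mevalZ raddf_sum /= big1 => [/esym/eqP|i _]; last by rewrite mevalM h mulr0.
by rewrite mulf_eq0 pnatr_eq0 -leqn0 leqNgt d0 /= => /eqP.
Qed.

Lemma smooth_finite_colength d f : (0 < d)%N -> f \is d.-homog ->
  smooth_hypersurface f -> finite_colength (jacobian_ideal f).
Proof.
move=> d0 hf sf; apply: contrapT.
move=> /(projective_nullstellensatz (jacobian_hideal hf)) [v hv hz].
suff : sing_locus f v by rewrite sf.
apply: (sing_locusP d0 hf hv) => i.
by apply: hz (mderiv_homog i hf) _; exact: jacobian_gen.
Qed.

(** The Jacobian ideal together with all isolating forms [h v] has no projective zero, so finitely
    many of them, indexed by [r], already give powers of all variables. A singular point outside [r]
    would be a common zero. *)
Lemma finite_sing_locus d f : (0 < d)%N -> f \is d.-homog ->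
  isolated_singularities f ->
  exists r : seq 'rV[K]_n.+1, sing_locus f `<=` [set v | v \in r].
Proof.
move=> d0 hf hiso.
have hH v : exists h : S, sing_locus f v -> [/\ exists e, h \is e.-homog,
    h.@[v 0] != 0 & forall w, sing_locus f w -> h.@[w 0] != 0 -> w = v].
  have [sv|nsv] := pselect (sing_locus f v); last by exists 0.
  by have [e [h [h1 h2 h3]]] := hiso v sv; exists h => _; split=> //; exists e.
have [h hP] := choice hH.
pose good (r : seq 'rV[K]_n.+1) := forall v, v \in r -> sing_locus f v.
pose J r : set S := adjs (jacobian_ideal f) (map h r).
have hJf := jacobian_hideal hf.
have hJ r : good r -> homog_ideal (J r).
  move=> gr; apply: (adjs_homog_ideal hJf) => _ /mapP [v /gr sv ->].
  by have [] := hP v sv.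
have good_cat r1 r2 : good r1 -> good r2 -> good (r1 ++ r2).
  by move=> g1 g2 v; rewrite mem_cat => /orP [/g1|/g2].
have J_mono r1 r2 : good r2 -> {subset r1 <= r2} -> J r1 `<=` J r2.
  move=> g2 s12; apply: adjs_min; first exact: hJ.
    exact: sub_adjs.
  by move=> _ /mapP [v /s12 vr ->]; apply: adjs_gen => //; exact: map_f.
pose H : set S := [set p | exists2 r, good r & J r p].
have hHI : homog_ideal H.
  split.
  - by exists [::] => //; exact: hideal0.
  - move=> p q [r1 g1 p1] [r2 g2 q2]; have g12 := good_cat _ _ g1 g2.
    exists (r1 ++ r2) => //; apply: (hidealD (hJ _ g12)).
      by apply: J_mono p1 => // v; rewrite mem_cat => ->.
    by apply: J_mono q2 => // v; rewrite mem_cat orbC => ->.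
  - by move=> p q [r gr qr]; exists r => //; apply: (hidealM (hJ r gr)).
  - by move=> k p [r gr pr]; exists r => //; apply: (hideal_pihomog (hJ r gr)).
have [N hN] : finite_colength H.
  apply: contrapT => /(projective_nullstellensatz hHI) [v hv hz].
  have sv : sing_locus f v.
    apply: (sing_locusP d0 hf hv) => i; apply: hz (mderiv_homog i hf) _.
    by exists [::] => //; exact: jacobian_gen.
  have [[e he] hv0 _] := hP v sv; move/eqP: hv0; apply; apply: hz he _.
  exists [:: v]; first by move=> w; rewrite inE => /eqP ->.
  by apply: adjs_gen => //=; rewrite mem_head.
have [r gr hr] : exists2 r, good r & forall i, i \in enum 'I_n.+1 -> J r ('X_i ^+ N).
  elim: (enum _) => [|i s [r gr hr]]; first by exists [::].
  have [r' gr' hi] : H ('X_i ^+ N).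
    by apply: hN; apply: linear_form_powX; exact: X_homog.
  have g12 := good_cat _ _ gr gr'; exists (r ++ r') => // j.
  rewrite inE => /predU1P [->|/hr {}hr].
    by apply: J_mono hi => // v; rewrite mem_cat orbC => ->.
  by apply: J_mono hr => // v; rewrite mem_cat => ->.
exists r => w sw /=; apply: contrapT => /negP wr.
have [[i [wi _]] _ fw] := sw.
have := hr i; rewrite mem_enum => /(_ isT); rewrite /J jacobian_idealE.
have -> : adjs (adjs [set 0] (gradient f)) [seq h i | i <- r] =
    adjs [set 0] (gradient f ++ [seq h i | i <- r]).
  by elim: (gradient f) [set 0] => //=.
move=> /(@meval_adjs _ _ _ (w 0)) E.
have /eqP : ('X_i ^+ N : S).@[w 0] = 0.
  apply: E => a; rewrite mem_cat => /orP [/mapP [j _ ->] //|/mapP [v vr ->]].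
  have [_ _ hv] := hP v (gr v vr); apply: contraNeq wr => /(hv w sw) -> //.
by rewrite rmorphXn /= mevalXU wi expr1n oner_eq0.
Qed.

(** The form with coefficients [1, t, t ^ 2, ...] takes at [v] the value of a nonzero polynomial in
    [t]. *)
Lemma exists_avoiding_hyperplane (r : seq 'rV[K]_n.+1) :
  exists l : S, [/\ l \is 1.-homog, l != 0 &
    forall v, v \in r -> v != 0 -> l.@[v 0] != 0].
Proof.
pose P (v : 'rV[K]_n.+1) : {poly K} := \poly_(j < n.+1) v 0 (inord j).
have P0 v : v != 0 -> P v != 0.
  apply: contra_neq => Pv; apply/rowP => j; rewrite mxE.
  have := congr1 (fun Q : {poly K} => Q`_j) Pv.
  by rewrite coef_poly ltn_ord coef0 inord_val.
have [|t] := @exists_nonroot _ (\prod_(v <- r | v != 0) P v).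
  by rewrite prodf_seq_neq0; apply/allP => v _; apply/implyP; exact: P0.
move=> ht; pose l : S := \sum_(j < n.+1) t ^+ j *: 'X_j.
have lE (v : 'I_n.+1 -> K) : l.@[v] = \sum_(j < n.+1) v j * t ^+ j.
  rewrite /l raddf_sum /=; apply: eq_bigr => j _.
  by rewrite mevalZ mevalXU mulrC.
exists l; split.
- by apply: rpred_sum => j _; apply: rpredZ; exact: X_homog.
- apply/eqP => l0; have := lE (fun j => (j == ord0)%:R).
  rewrite l0 meval0 (bigD1 ord0) //= big1 => [|j j0].
    by rewrite expr0 mulr1 addr0 => /esym/eqP; rewrite oner_eq0.
  by rewrite (negbTE j0) mul0r.
- move=> v vr v0; move: ht; rewrite horner_prod prodf_seq_neq0 => /allP /(_ v vr).
  rewrite v0 /=; suff -> : l.@[v 0] = (P v).[t] by [].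
  by rewrite horner_poly lE; apply: eq_bigr => j _; rewrite inord_val.
Qed.

Lemma exists_transverse_hyperplane d f : (0 < d)%N -> f \is d.-homog ->
  isolated_singularities f -> exists l : S, [/\ l \is 1.-homog, l != 0 &
    finite_colength (adj (jacobian_ideal f) l)].
Proof.
move=> d0 hf hiso; have [r hr] := finite_sing_locus d0 hf hiso.
have [l [hl l0 lr]] := exists_avoiding_hyperplane r; exists l; split=> //.
have hJ := jacobian_hideal hf; have hJl := adj_hideal hJ hl.
apply: contrapT => /(projective_nullstellensatz hJl) [v hv hz].
have sv : sing_locus f v.
  apply: (sing_locusP d0 hf hv) => i; apply: hz (mderiv_homog i hf) _.
  by apply: sub_adj; exact: jacobian_gen.
have v0 : v != 0.
  case: hv => i [vi _]; apply/eqP => v0; move: vi; rewrite v0 mxE => /esym/eqP.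
  by rewrite oner_eq0.
move/eqP: (lr v (hr v sv) v0); apply; apply: (hz _ _ hl).
by rewrite -[X in adj _ _ X]mul1r; exact: adj_gen.
Qed.

(* [n + 1] forms of degree [e] are algebraically dependent modulo a linear form [l], by
   comparing dimensions in large degree. *)
Lemma exists_relation e (l : S) (u : n.+1.-tuple S) : (0 < e)%N ->
  l \is 1.-homog -> l != 0 -> (forall i, tnth u i \is e.-homog) ->
  exists N (P : {mpoly K[n.+1]}), [/\ P \is N.-homog, P != 0 &
    adj [set 0] l (P \mPo u)].
Proof.
move=> e0 hl l0 hu; have [N N0 hN] := exists_bin_gt n e0.
have hC := adj_hideal (homog_ideal0 K n) hl; set C := adj _ l in hC *.
have hphi (P : dhomog n.+1 K N) : (mpoly_of_dhomog P \mPo u) \is (e * N).-homog.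
  by apply: comp_mpoly_homog => //; exact: dhomog_is_dhomog.
pose phi (P : dhomog n.+1 K N) : dhomog n.+1 K (e * N) := DHomog (hphi P).
have lphi : linear phi by move=> c P Q; apply: val_inj => /=; rewrite linearP.
pose phi_linear := GRing.isLinear.Build K _ _ _ phi lphi.
pose F : {linear dhomog n.+1 K N -> dhomog n.+1 K (e * N)} := HB.pack phi phi_linear.
have sdim k : \dim {:dhomog n.+1 K k} = 'C(k + n, k) by rewrite dimvf.
have dC : hdim C (e * N) = 'C((e * N).-1 + n, (e * N).-1).
  have eN : ((e * N).-1 + 1)%N = (e * N)%N by rewrite addn1 prednK // muln_gt0 e0.
  have := hdim_adj_regular (e * N).-1 (homog_ideal0 K n) hl (regular_mod0 l0).
  have h0 k : hdim ([set 0] : set S) k = 0%N.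
    apply/eqP; rewrite dimv_eq0 -subv0; apply/subvP => v /mem_hcomp.
    move=> /(_ (homog_ideal0 K n)) /= v0; rewrite memv0; apply/eqP; exact: val_inj.
  by rewrite eN !h0 addn0 add0n sdim.
have := dim_lpreim (linfun F) (hcomp C (e * N)).
have : (\dim (hcomp C (e * N) + limg (linfun F)) <= 'C(e * N + n, e * N))%N.
  by rewrite -sdim dimvS ?subvf.
rewrite -/(hdim C (e * N)) dC sdim => h1 h2.
have : (linfun F @^-1: hcomp C (e * N))%VS != 0%VS.
  rewrite -dimv_eq0; apply/eqP => h; move: h1 hN; rewrite h addn0 in h2.
  by rewrite h2 addnC leqNgt => /negP.
rewrite -vpick0; set P := vpick _ => P0; exists N, (mpoly_of_dhomog P).
split; first exact: dhomog_is_dhomog.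
  by apply: contra_neq P0 => P0; exact: val_inj.
have := memv_pick (linfun F @^-1: hcomp C (e * N)).
by rewrite -memv_preim lfunE /= mem_hcomp.
Qed.

(* A relation between the partial derivatives modulo [l] is monic in [f_0] after a
   generic substitution [f_j = g_j + c_j f_0], so a power of [f_0] is in the ideal
   [(g, l)]. *)
Lemma exists_jacobian_reduction d f : (1 < d)%N -> f \is d.-homog ->
  isolated_singularities f -> exists (g : seq S) (l : S),
  [/\ size g = n, {in g, forall u, u \is d.-1.-homog}, l \is 1.-homog,
      finite_colength (adj (adjs [set 0] g) l) &
      jacobian_ideal f = adj (adjs [set 0] g) f^`M(ord0)].
Proof.
move=> d1 hf hiso; have d0 : (0 < d)%N by lia.
have e0 : (0 < d.-1)%N by lia.
have [l [hl l0 fl]] := exists_transverse_hyperplane d0 hf hiso.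
pose u := [tuple f^`M(i) | i < n.+1].
have hu i : tnth u i \is d.-1.-homog by rewrite tnth_mktuple mderiv_homog.
have [N [P [hP P0 lP]]] := exists_relation e0 hl l0 hu.
have [c' [c'0 Pc']] := exists_nonvanishing P0.
(* As [P] is homogeneous, its point of nonvanishing can be scaled so that the coordinate of [f_0] is
   1. *)
pose c i := (c' ord0)^-1 * c' i.
have Pc : P.@[c] != 0.
  by rewrite (meval_homog_scale _ _ hP) mulf_neq0 // expf_neq0 // invr_eq0.
have c0 : c ord0 = 1 by rewrite /c mulVf.
pose f0 := f^`M(ord0); have hf0 : f0 \is d.-1.-homog := mderiv_homog ord0 hf.
pose g := [seq f^`M(lift ord0 j) - c (lift ord0 j) *: f0 | j <- enum 'I_n].
have hg : {in g, forall u, u \is d.-1.-homog}.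
  by move=> _ /mapP [j _ ->]; apply: rpredB; [|apply: rpredZ]; exact: mderiv_homog.
have h0 := homog_ideal0 K n; have hI := adjs_hideal h0 hg.
have gI i : adjs [set 0] g (f^`M(i) - c i *: f0).
  case: (unliftP ord0 i) => [j ->|->]; last by rewrite c0 scale1r subrr; exact: hideal0.
  by apply: (adjs_gen h0); apply/mapP; exists j; rewrite ?mem_enum.
have hIf := adj_hideal hI hf0; have hIl := adj_hideal hI hl.
have hJ := jacobian_hideal hf.
have JE : jacobian_ideal f = adj (adjs [set 0] g) f0.
  apply/seteqP; split.
    rewrite jacobian_idealE; apply: (adjs_min hIf) => [_ ->|_ /mapP [i _ ->]].
      exact: hideal0.
    by exists (c i)%:MP; rewrite mul_mpolyC.
  apply: (adj_min hJ); last exact: jacobian_gen.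
  apply: (adjs_min hJ) => [_ ->|_ /mapP [j _ ->]]; first exact: hideal0.
  by apply: (hidealB hJ); [|apply: (hidealZ hJ)]; exact: jacobian_gen.
exists g, l; split=> //; first by rewrite size_map size_enum_ord.
apply: (finite_colength_radical hIl hf0 (N := N)); last first.
  by rewrite adjC -JE.
apply: (hidealZK hIl Pc); rewrite -(comp_mpoly_scale _ _ hP).
rewrite -(subKr (P \mPo u) (P \mPo _)); apply: (hidealB hIl).
  by apply: adj_mono lP => _ ->; exact: hideal0.
apply: (comp_mpoly_congr _ hIl) => i; rewrite !tnth_mktuple.
by apply: sub_adj; exact: gI.
Qed.

End SingularLocus.

(** The powers [x_i ^ e] have the four properties by inspection of monomials. The first two pass to
    [g] by [regular_exchange], the others because the Hilbert functions agree. *)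
Lemma complete_intersection (K : numFieldType) n e (g : seq {mpoly K[n.+1]}) :
  (0 < e)%N -> size g = n.+1 -> {in g, forall u, u \is e.-homog} ->
  finite_colength (adjs [set 0] g) ->
  [/\ regular_seq [set 0] g,
    forall k, (k < n.+1 * e.-1)%N -> socle_free (adjs [set 0] g) k,
    forall k p, (n.+1 * e.-1 < k)%N -> p \is k.-homog -> adjs [set 0] g p &
    (\dim {:dhomog n.+1 K (n.+1 * e.-1)} <=
      (hdim (adjs [set 0%R] g) (n.+1 * e.-1)).+1)%N].
Proof.
move=> e0 sg hg fg; have h0 := homog_ideal0 K n.
pose x : seq {mpoly K[n.+1]} := powers K e (enum 'I_n.+1).
have hx : {in x, forall u, u \is e.-homog} := @powers_homog K n e _.
have sx : size x = size g by rewrite size_map size_enum_ord sg.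
have rx : regular_seq [set 0] x by apply: powers_regular; exact: enum_uniq.
have fx : finite_colength (adjs [set 0] x).
  by exists (n.+1 * e.-1).+1 => p; exact: powers_full.
have [rg sfg] := regular_exchange h0 e0 sx hx hg rx fx fg.
have dxg k : hdim (adjs [set 0] x) k = hdim (adjs [set 0] g) k.
  exact: (hdim_regular_seq h0 h0 sx hx hg rx rg).
split=> // [k ke|k p ke hp|].
- by apply: sfg; exact: powers_socle_free.
- apply: ((hdim_full k (adjs_hideal h0 hg)).1 _ p hp); rewrite -dxg.
  by apply: (hdim_full k (adjs_hideal h0 hx)).2 => q; exact: powers_full.
- by rewrite -dxg; exact: powers_codim.
Qed.

(** * Gorenstein duality as linear algebra on graded pieces *)

Section Duality.
Variables (K : fieldType) (n : nat).
Local Notation S := {mpoly K[n.+1]}.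
Local Notation Sk k := (dhomog n.+1 K k).
Implicit Types (I J : set S) (p q a b : S).

Lemma dim_cap_lpreim (V W : vectType K) (f : 'Hom(V, W)) (X : {vspace V}) (Z : {vspace W}) :
  (\dim {:W} <= (\dim Z).+1)%N -> (\dim X <= (\dim (X :&: f @^-1: Z)).+1)%N.
Proof.
move=> cZ; have h1 := dimv_sum_cap X (f @^-1: Z); have h2 := dim_lpreim f Z.
have h3 : (\dim (Z + limg f) <= \dim {:W})%N by rewrite dimvS ?subvf.
have h4 : (\dim (X + f @^-1: Z) <= \dim {:V})%N by rewrite dimvS ?subvf.
by move: h1 h2 h3 h4 cZ; lia.
Qed.

(* Each linear condition [a * y \in Z] with [Z] a hyperplane costs at most one dimension. *)
Lemma exists_annihilator k k' (Y U : {vspace Sk k}) (Z : {vspace Sk k'}) :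
  (\dim {:Sk k'} <= (\dim Z).+1)%N -> (U <= Y)%VS -> Y != fullv ->
  (forall (a u : Sk k), u \in U -> hmul (mpoly_of_dhomog u) k' a \in Z) ->
  exists2 a : Sk k, a \notin U &
    forall y, y \in Y -> hmul (mpoly_of_dhomog y) k' a \in Z.
Proof.
move=> cZ UY YT aU.
pose V (ys : seq (Sk k)) : {vspace Sk k} :=
  foldr (fun y W => W :&: linfun (@hmul _ _ (mpoly_of_dhomog y) k k') @^-1: Z)%VS fullv ys.
have dV ys : (\dim {:Sk k} <= \dim (V ys) + size ys)%N.
  elim: ys => [|y ys IH] /=; first by rewrite addn0.
  rewrite addnS; apply: leq_trans IH _; rewrite -addSn leq_add2r.
  exact: dim_cap_lpreim.
have VP ys (a y : Sk k) : a \in V ys -> y \in ys -> hmul (mpoly_of_dhomog y) k' a \in Z.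
  elim: ys => //= z ys IH /memv_capP [aV az]; rewrite inE => /predU1P [->|/(IH aV)//].
  by move: az; rewrite -memv_preim lfunE.
(* Only a complement [D] of [U] in [Y] imposes conditions; as [Y] is not everything, there are fewer
   of them than the codimension of [U], so [V ys] cannot lie in [U]. *)
pose D := (Y :\: U)%VS; pose ys : seq (Sk k) := vbasis D.
have dD : (\dim U + \dim D = \dim Y)%N by rewrite -(dimv_cap_compl Y U) (capv_idPr UY).
have YltT : (\dim Y < \dim {:Sk k})%N.
  rewrite ltn_neqAle dimvS ?subvf // andbT; apply: contra YT => /eqP h.
  by rewrite eqEdim subvf h /=.
have /subvPn [a aV aU'] : ~~ (V ys <= U)%VS.
  apply/negP => /dimvS h; have := dV ys; rewrite size_tuple.
  by move: h dD YltT; lia.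
exists a => // y; rewrite -(addv_diff_cap Y U) => /memv_addP [w wD [u]].
rewrite (capv_idPr UY) => uU ->.
have -> : hmul (mpoly_of_dhomog (w + u)) k' a =
    hmul (mpoly_of_dhomog w) k' a + hmul (mpoly_of_dhomog u) k' a.
  by apply: val_inj; rewrite /= mulrDr raddfD.
apply: rpredD; last exact: aU.
rewrite (coord_vbasis wD).
have -> : hmul (mpoly_of_dhomog (\sum_i coord (vbasis D) i w *: (vbasis D)`_i)) k' a =
    \sum_i coord (vbasis D) i w *: hmul (mpoly_of_dhomog (vbasis D)`_i) k' a.
  apply: val_inj; rewrite /= !raddf_sum /= mulr_sumr raddf_sum /=.
  by apply: eq_bigr => i _; rewrite -scalerAr linearZ.
apply: rpred_sum => i _; apply/rpredZ/(VP ys) => //.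
by rewrite mem_nth // size_tuple.
Qed.

Lemma adj_powM I l r j p : homog_ideal I -> regular_mod I l ->
  adj I (l ^+ (r + j)) (p * l ^+ j) <-> adj I (l ^+ r) p.
Proof.
move=> hI rl; split=> -[q h]; exists q.
  apply: (regular_modX (k := j) rl).
  by rewrite mulrBl -mulrA -exprD.
by rewrite exprD mulrA -mulrBl; exact: hidealMr.
Qed.

(** * Duality for [S / I] of dimension one, read off from its finite quotient by [l ^ e] *)

Section OneDimensional.
Variables (I : set S) (hI : homog_ideal I) (e t : nat) (l : S).
Hypothesis (e0 : (0 < e)%N) (hl : l \is 1.-homog) (rl : regular_mod I l).
Local Notation B := (adj I (l ^+ e)).
Hypothesis soc : forall k, (k < t + e.-1)%N -> socle_free B k.
Hypothesis full : forall k p, (t + e.-1 < k)%N -> p \is k.-homog -> B p.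
Hypothesis codim : (\dim {:Sk (t + e.-1)} <= (hdim B (t + e.-1)).+1)%N.

Let hlX k : l ^+ k \is k.-homog.
Proof. exact: linear_form_powX. Qed.

Let hB : homog_ideal B := adj_hideal hI (hlX e).
Let hC : homog_ideal (adj I l) := adj_hideal hI hl.

(** Since [l] is regular, multiplication by [l ^+ e.-1] embeds [S / (I, l)] into [S / B]. *)
Let adj_lB p : adj I l p <-> B (p * l ^+ e.-1).
Proof.
by have := @adj_powM I l 1 e.-1 p hI rl; rewrite expr1 add1n (prednK e0) => ->.
Qed.

(** Below the top degree a nonzero class is not in the socle, so one variable after another carries
    it up to the top. *)
Lemma socle_witness m i p : (i + m = t + e.-1)%N -> p \is i.-homog -> ~ B p ->
  exists2 b, b \is m.-homog & ~ B (p * b).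
Proof.
elim: m i p => [|m IH] i p im hp nB.
  by exists 1; rewrite ?mulr1 //; exact: dhomog1.
have [j nj] : exists j, ~ B ('X_j * p).
  apply: contrapT => h; apply: nB; apply: (soc (k := i)) => // [|j]; first by lia.
  by apply: contrapT => nj; apply: h; exists j.
have [||b hb nb] := IH i.+1 ('X_j * p) _ _ nj; first by lia.
  exact: (dhomogM (X_homog K j) hp).
exists ('X_j * b); last by rewrite mulrCA mulrA.
exact: (dhomogM (X_homog K j) hb).
Qed.

(** The pairing of [S / B] is pulled back along the embedding by [l ^+ e.-1], which lowers the top
    degree to [t]. *)
Lemma section_witness i p : p \is i.-homog -> ~ adj I l p ->
  (i <= t)%N /\ exists2 b, b \is (t - i).-homog & ~ adj I l (p * b).
Proof.
move=> hp; rewrite adj_lB => nB.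
have hpl : p * l ^+ e.-1 \is (i + e.-1).-homog by apply: dhomogM.
have it : (i <= t)%N.
  by rewrite leqNgt; apply/negP => ti; apply: nB; apply: full hpl; rewrite ltn_add2r.
split=> //; have [|b hb nb] := socle_witness (m := (t - i)%N) _ hpl nB; first by lia.
by exists b => //; rewrite adj_lB mulrAC.
Qed.

Lemma section_full k p : (t < k)%N -> p \is k.-homog -> adj I l p.
Proof. by move=> tk hp; apply: contrapT => /(section_witness hp) [+ _]; lia. Qed.

(* With [A_j] the forms of degree [j] divided by [l^j] modulo [I], this reads: if
   [a A_j] lies in [A_(t-1)] then [a] lies in [A_(t-1-j)], and [a = 0] when [t <= j]. *)
Lemma annihilator_degree i j a : a \is i.-homog ->
  (forall b, b \is j.-homog -> adj I (l ^+ ((i + j).+1 - t)) (a * b)) ->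
  adj I (l ^+ ((i + j).+1 - t)) a.
Proof.
move=> ha; set r := ((i + j).+1 - t)%N => h.
(* Factors [l] are split off singly: write [a] as [a' * l ^+ u] modulo [I]. Were [a'] not in
   [(I, l)], the partner [b] of [a'], padded by [l ^+ m] to degree [j], would contradict [h]. *)
suff : forall u, (u <= r)%N -> adj I (l ^+ u) a by apply.
elim=> [_|u IH ur]; first by exists a; rewrite expr0 mulr1 subrr; exact: hideal0.
have [a' ha' Ia'] := adj_homogP hI (hlX u) ha (IH (ltnW ur)).
case: (ltnP i u) => iu.
  by apply: sub_adj; apply: (adj_lt hI (hlX u) ha iu); exists a'.
suff [q Iq] : adj I l a'.
  exists q; have -> : a - q * l ^+ u.+1 = (a - a' * l ^+ u) + (a' - q * l) * l ^+ u.
    by rewrite exprS; ring.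
  by apply: (hidealD hI) => //; exact: hidealMr.
apply: contrapT => /(section_witness ha') [iut [b hb]]; apply.
pose m := (j - (t - (i - u)))%N.
have hbm : b * l ^+ m \is j.-homog.
  have -> : j = (t - (i - u) + m)%N by rewrite /m; lia.
  exact: dhomogM.
have := h _ hbm; have -> : r = (1 + (u + m))%N by rewrite /r /m; lia.
have hr : adj I (l ^+ (1 + (u + m))) ((a - a' * l ^+ u) * (b * l ^+ m)).
  by apply: sub_adj; exact: hidealMr.
have hA : homog_ideal (adj I (l ^+ (1 + (u + m)))) by exact: adj_hideal (hlX _).
move=> /(hidealB hA) /(_ hr).
have -> : a * (b * l ^+ m) - (a - a' * l ^+ u) * (b * l ^+ m) =
    (a' * b) * l ^+ (u + m) by rewrite exprD; ring.
by rewrite adj_powM // expr1.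
Qed.

(** From degree [t] on, multiplication by [l] is onto modulo [I] as well as injective. *)
Lemma section_hdim j : (\dim {:Sk (t + j)} + hdim I t = hdim I (t + j) + \dim {:Sk t})%N.
Proof.
elim: j => [|j IH]; first by rewrite addn0 addnC.
have := hdim_adj_regular (t + j) hI hl rl.
have -> : hdim (adj I l) (t + j + 1) = \dim {:Sk (t + j + 1)}.
  by apply/(hdim_full _ hC) => p; apply: section_full; lia.
by rewrite -addnA addn1; lia.
Qed.

(** The codimension is the difference of the Hilbert function of [S / I] between degrees [t + j] and
    [t - 1]. It does not depend on [j], and [codim] bounds it for [j = e.-1]. *)
Lemma section_codim j :
  (\dim {:Sk (t + j)} <= (hdim (adj I (l ^+ j.+1)) (t + j)).+1)%N.
Proof.
have hj := section_hdim j; have he := section_hdim e.-1.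
have hE : (\dim {:Sk (t + e.-1)} <= (hdim (adj I (l ^+ e.-1.+1)) (t + e.-1)).+1)%N.
  by rewrite (prednK e0); exact: codim.
have [t0|t0] := posnP t.
  have hlt i : hdim (adj I (l ^+ i.+1)) (t + i) = hdim I (t + i).
    by apply: (hdim_adj_lt hI (hlX _)); rewrite t0.
  rewrite hlt in hE; rewrite hlt; move: hj he hE; lia.
have reg i : (hdim (adj I (l ^+ i.+1)) (t + i) + hdim I t.-1 =
    hdim I (t + i) + \dim {:Sk t.-1})%N.
  have -> : (t + i = t.-1 + i.+1)%N by lia.
  by apply: hdim_adj_regular (hlX _) _ => //; exact: regular_modX.
by move: hj he hE (reg j) (reg e.-1); lia.
Qed.

(** Otherwise some [a] outside [I] is orthogonal to [Y]. Orthogonality to multiples of [g] gives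
    [a * g] in [I]; orthogonality to multiples of [l ^+ (m - k)] makes [a] a form [b] of degree
    [t.-1 - k] times a power of [l], or 0 if [t <= k]. Then [b * g] is in [I], hence [b] and [a]
    are. *)
Lemma section_surjective g k m : g \is e.-homog -> (t + e <= m)%N -> (k <= m)%N ->
  (forall b, (k < t)%N -> b \is (t.-1 - k).-homog -> I (b * g) -> I b) ->
  forall p, p \is m.-homog -> adj (adj I g) (l ^+ (m - k)) p.
Proof.
move=> hg tem km hgI p hp.
have hIg := adj_hideal hI hg; set Y := adj (adj I g) _.
have hY : homog_ideal Y := adj_hideal hIg (hlX _).
(* Products of two forms of degree [m] have degree [M], where [(I, l ^+ r)] has codimension at most
   one and stands for [A_(t-1)]. *)
pose M := (m + m)%N; pose r := (M.+1 - t)%N.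
have hZ : homog_ideal (adj I (l ^+ r)) := adj_hideal hI (hlX r).
have Ir (a : S) : a \is m.-homog -> adj I (l ^+ r) a -> I a.
  by move=> ha; apply: (adj_lt hI (hlX r) ha); rewrite /r /M; lia.
apply: contrapT => nYp.
have mulE (a y : Sk m) : mpoly_of_dhomog (hmul (mpoly_of_dhomog y) M a) =
    mpoly_of_dhomog a * mpoly_of_dhomog y.
  by apply: hmulE; [exact: dhomog_is_dhomog|].
have [||||a aI aY] :=
  @exists_annihilator m M (hcomp Y m) (hcomp I m) (hcomp (adj I (l ^+ r)) M).
- have := section_codim (M - t); rewrite (_ : t + (M - t) = M)%N; last by rewrite /M; lia.
  by rewrite (_ : (M - t).+1 = r)%N //; rewrite /r /M; lia.
- apply/subvP => v /mem_hcomp -/(_ hI) Iv; apply/mem_hcomp => //.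
  by do 2 apply: sub_adj.
- apply/eqP => YT; apply: nYp; have := memvf (DHomog hp); rewrite -YT.
  by move=> /mem_hcomp -/(_ hY).
- move=> v u /mem_hcomp -/(_ hI) Iu; apply/mem_hcomp => //; rewrite mulE.
  by apply: sub_adj; exact: hidealM.
have {}aI : ~ I (mpoly_of_dhomog a) by move=> Ia; move/negP: aI; apply; apply/mem_hcomp.
have {}aY y : y \is m.-homog -> Y y -> adj I (l ^+ r) (mpoly_of_dhomog a * y).
  move=> hy Yy; have /aY : DHomog hy \in hcomp Y m by apply/mem_hcomp.
  by move=> /mem_hcomp -/(_ hZ); rewrite mulE.
have ha := dhomog_is_dhomog a; set a' := mpoly_of_dhomog a in aI aY ha.
have Iag : I (a' * g).
  have hag : a' * g \is (m + e).-homog by apply: dhomogM.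
  have rE : r = ((m + e + (m - e)).+1 - t)%N by rewrite /r /M; lia.
  apply: (@adj_lt _ _ I r (l ^+ r) (m + e)) => //; first by rewrite /r /M; lia.
  rewrite rE; apply: annihilator_degree => // b hb; rewrite -rE.
  rewrite -mulrA; apply: aY.
    by have -> : m = (e + (m - e))%N by [lia|]; exact: dhomogM.
  by rewrite mulrC; apply: sub_adj; exact: adj_gen.
have Yl b : b \is k.-homog -> adj I (l ^+ ((m + k).+1 - t)) (a' * b).
  move=> hb; have : adj I (l ^+ r) (a' * (b * l ^+ (m - k))).
    apply: aY; last exact: adj_gen.
    by rewrite -[X in X.-homog](subnKC km); exact: dhomogM.
  rewrite mulrA (_ : r = (m + k).+1 - t + (m - k))%N ?adj_powM //.
  by rewrite /r /M; lia.
have := annihilator_degree ha Yl; case: (leqP t k) => tk.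
  by move=> h; apply: aI; apply: (adj_lt hI (hlX _) ha) h; lia.
move=> /(adj_homogP hI (hlX _) ha) [b].
have -> : (m - ((m + k).+1 - t) = t.-1 - k)%N by lia.
move=> hb Ib; apply: aI; apply: (hidealBr hI _ Ib); apply: (hidealMr hI).
apply: hgI => //; apply: (regular_modX (k := ((m + k).+1 - t)%N) rl).
have -> : b * g * l ^+ ((m + k).+1 - t) = a' * g - (a' - b * l ^+ ((m + k).+1 - t)) * g.
  by ring.
by apply: (hidealB hI) => //; exact: hidealMr.
Qed.

End OneDimensional.
End Duality.

(** * Dimensions of the Milnor algebra in terms of the Jacobian ideal *)

Section MilnorAlgebra.
Variables (K : fieldType) (n : nat).
Local Notation S := {mpoly K[n.+1]}.
Local Notation Sk k := (dhomog n.+1 K k).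

Lemma quotient_basis_dim (J : set S) k r (e : 'I_r -> S) : homog_ideal J ->
  quotient_basis (homog_comp k) J e -> (hdim J k + r = \dim {:Sk k})%N.
Proof.
move=> hJ [he hu].
pose E i : Sk k := DHomog (he i).
pose psi (c : 'rV[K]_r) : Sk k := \sum_i c 0 i *: E i.
have lpsi : linear psi.
  move=> a c c'; rewrite /psi scaler_sumr -big_split; apply: eq_bigr => i _ /=.
  by rewrite !mxE scalerDl scalerA.
pose psi_linear := GRing.isLinear.Build K _ _ _ psi lpsi.
pose F : {linear 'rV[K]_r -> Sk k} := HB.pack psi psi_linear.
have valF c : mpoly_of_dhomog (psi c) = \sum_i c 0 i *: e i.
  by rewrite raddf_sum.
have := dim_lpreim (linfun F) (hcomp J k).
have -> : (hcomp J k + limg (linfun F))%VS = fullv.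
  apply/vspaceP => v; rewrite memvf; apply/idP.
  have [c [hc _]] := hu _ (dhomog_is_dhomog v).
  rewrite -(subrK (linfun F c) v); apply: memv_add; last exact: memv_img (memvf _).
  by apply/mem_hcomp => //; rewrite lfunE raddfB /= valF.
have -> : (linfun F @^-1: hcomp J k)%VS = 0%VS.
  apply/eqP; rewrite -subv0; apply/subvP => c.
  rewrite -memv_preim lfunE /= => /mem_hcomp -/(_ hJ); rewrite valF => Jc.
  (* Both [c] and the zero row are coordinates of the zero form, so uniqueness identifies them. *)
  have [|c0 [_ uc]] := hu 0; first exact: dhomog0.
  rewrite memv0; apply/eqP; rewrite -(uc c); last by rewrite sub0r; exact: hidealN.
  by apply: uc; rewrite big1 ?subrr => [|i _]; [exact: hideal0|rewrite mxE scale0r].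
by rewrite dimv0 addn0 dimvf /dim /= mul1n => ->.
Qed.

Lemma exists_quotient_basis (J : set S) k : homog_ideal J ->
  exists r, exists e : 'I_r -> S, quotient_basis (homog_comp k) J e.
Proof.
move=> hJ; pose D := ((hcomp J k)^C)%VS; pose b := vbasis D.
exists (\dim D), (fun i => mpoly_of_dhomog b`_i); split=> [i|u hu].
  exact: dhomog_is_dhomog.
have hv (c : 'rV[K]_(\dim D)) : \sum_i c 0 i *: mpoly_of_dhomog b`_i =
    mpoly_of_dhomog (\sum_(i < \dim D) c 0 i *: b`_i).
  by rewrite raddf_sum.
pose v : Sk k := DHomog hu.
have hJv (c : 'rV[K]_(\dim D)) : J (u - \sum_i c 0 i *: mpoly_of_dhomog b`_i) <->
    v - \sum_(i < \dim D) c 0 i *: b`_i \in hcomp J k.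
  by rewrite mem_hcomp // raddfB /= hv.
have /memv_addP [w wJ [x xD vwx]] : v \in (hcomp J k + D)%VS.
  by rewrite addv_complf memvf.
have bD (c : 'rV[K]_(\dim D)) : \sum_(i < \dim D) c 0 i *: b`_i \in D.
  by apply: rpred_sum => i _; apply/rpredZ/vbasis_mem/mem_nth; rewrite size_tuple.
exists (\row_i coord b i x); split.
  apply/hJv; under eq_bigr do rewrite mxE.
  by rewrite -(coord_vbasis xD) vwx addrK.
move=> c /hJv hc; apply/rowP => i; rewrite mxE.
have : x - \sum_(i < \dim D) c 0 i *: b`_i \in (hcomp J k :&: D)%VS.
  apply/memv_capP; split; last by apply: rpredB.
  have -> : x - \sum_(i < \dim D) c 0 i *: b`_i = (v - \sum_(i < \dim D) c 0 i *: b`_i) - w.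
    by rewrite vwx addrAC [w + x]addrC addrK.
  exact: rpredB.
rewrite capv_compl memv0 subr_eq0 => /eqP ->.
by rewrite (coord_sum_free _ _ (basis_free (vbasisP D))).
Qed.

(** A quotient basis exists and its size is forced, so the default value in [quotient_dim] does not
    occur. *)
Lemma milnor_dimE d (f : S) k : f \is d.-homog ->
  (hdim (jacobian_ideal f) k + milnor_dim f k = \dim {:Sk k})%N.
Proof.
move=> /jacobian_hideal hJ; rewrite /milnor_dim /quotient_dim.
have [r re] := exists_quotient_basis k hJ.
rewrite (@xget_unique _ _ _ r) // => [|r' [e' he']].
  by have [e he] := re; exact: quotient_basis_dim he.
have [e he] := re; apply/eqP; rewrite -(eqn_add2l (hdim (jacobian_ideal f) k)).
by rewrite (quotient_basis_dim hJ he) (quotient_basis_dim hJ he').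
Qed.

Lemma eq_milnor_dim d (f g : S) k : f \is d.-homog -> g \is d.-homog ->
  milnor_dim f k = milnor_dim g k ->
  hdim (jacobian_ideal f) k = hdim (jacobian_ideal g) k.
Proof.
move=> hf hg E; apply/eqP; rewrite -(eqn_add2r (milnor_dim f k)).
by rewrite (milnor_dimE _ hf) E (milnor_dimE _ hg).
Qed.

(** Multiplication by [l] is onto between spaces of equal finite dimension, hence injective. *)
Lemma milnor_dim_surjective d e (f l s : S) k : f \is d.-homog -> l \is e.-homog ->
  milnor_dim f (k + e) = milnor_dim f k ->
  (forall p, p \is (k + e).-homog -> adj (jacobian_ideal f) l p) ->
  s \is k.-homog -> jacobian_ideal f (s * l) -> jacobian_ideal f s.
Proof.
move=> hf hl E sur; have hJ := jacobian_hideal hf.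
apply: (hdim_adj_colon hJ hl); rewrite ((hdim_full _ (adj_hideal hJ hl)).2 sur).
by rewrite -(milnor_dimE (k + e) hf) -(milnor_dimE k hf) E addnAC addnA.
Qed.

End MilnorAlgebra.

(** * The saturation in one degree *)

Section Saturation.
Variables (K : numClosedFieldType) (n : nat).
Local Notation S := {mpoly K[n.+1]}.

(** The colon ideal of [s] contains a power of each variable, hence all forms of large degree, among
    them powers of [l]. *)
Lemma saturation_power (J : set S) k (s l : S) : homog_ideal J -> s \is k.-homog ->
  l \is 1.-homog -> saturation J s ->
  exists N, forall r, (N <= r)%N -> J (s * l ^+ r).
Proof.
move=> hJ hs hl sJ; have hQ := colon_hideal hJ hs.
have h i : exists m, J ('X_i ^+ m * s) by have [m _ Jm] := sJ i; exists m.
have [m hm] := choice h.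
pose M := (\max_i m i).+1.
have [N hN] : finite_colength (colon J s).
  apply: (powers_colength (e := M) hQ) => // i.
  have mM : (m i <= M)%N by rewrite leqW // leq_bigmax.
  by rewrite -(subnK mM) exprD /colon /= -mulrA; exact: hidealM.
exists N => r Nr; rewrite mulrC; apply: (hideal_deg hQ hN Nr).
exact: linear_form_powX.
Qed.

Lemma saturation_eq d (f fs : S) k : (1 < d)%N ->
  f \is d.-homog -> isolated_singularities f ->
  fs \is d.-homog -> smooth_hypersurface fs ->
  (forall j, (k <= j)%N -> milnor_dim f j = milnor_dim f k) ->
  ((k <= n.+1 * (d - 2))%N ->
    milnor_dim f (n.+1 * (d - 2) - k) = milnor_dim fs (n.+1 * (d - 2) - k)) ->
  forall s, s \is k.-homog -> saturation (jacobian_ideal f) s -> jacobian_ideal f s.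
Proof.
move=> d1 hf hiso hfs hsm hst hct s hs sats.
have d0 : (0 < d)%N by lia.
pose e := d.-1; have e0 : (0 < e)%N by rewrite /e; lia.
have [g [l [sg hg hl fgl JE]]] := exists_jacobian_reduction d1 hf hiso.
have h0 := homog_ideal0 K n; set I : set S := adjs [set 0] g in fgl JE *.
have hI : homog_ideal I := adjs_hideal h0 hg.
have hle : l ^+ e \is e.-homog by exact: linear_form_powX.
have hgl : {in rcons g (l ^+ e), forall u, u \is e.-homog}.
  by move=> u; rewrite mem_rcons inE => /predU1P [->|/hg].
have hB := adj_hideal hI hle.
have fB : finite_colength (adj I (l ^+ e)).
  apply: (finite_colength_radical hB hl (N := e)).
    by rewrite -[X in adj _ _ X]mul1r; exact: adj_gen.
  by rewrite adjC; apply: finite_colengthS fgl; exact: sub_adj.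
have [||] := complete_intersection e0 _ hgl; first by rewrite size_rcons sg.
  by rewrite adjs_rcons.
rewrite regular_seq_rcons adjs_rcons -/I => -[rg rle] soc full codim.
have rl := regular_modXW hI e0 rle.
set f0 := f^`M(ord0) in JE; have hf0 : f0 \is e.-homog := mderiv_homog ord0 hf.
set J := jacobian_ideal f in sats JE *; have hJ : homog_ideal J := jacobian_hideal hf.
(* The partial derivatives of [fs] form a regular sequence. This gives the model for comparison:
   [I'] has the Hilbert function of [I], and [f0'] is regular modulo [I']. *)
pose g' := [seq fs^`M(lift ord0 j) | j <- enum 'I_n].
have hg' : {in g', forall u, u \is e.-homog}.
  by move=> _ /mapP [j _ ->]; exact: mderiv_homog.
set I' : set S := adjs [set 0] g'; have hI' : homog_ideal I' := adjs_hideal h0 hg'.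
set f0' := fs^`M(ord0); have hf0' : f0' \is e.-homog := mderiv_homog ord0 hfs.
have JE' : jacobian_ideal fs = adj I' f0'.
  by rewrite jacobian_idealE /gradient enum_ordSl /= -map_comp adjs_adj.
have fJ' := smooth_finite_colength d0 hfs hsm.
have [|||] := @complete_intersection K n e (rcons g' f0') e0.
- by rewrite size_rcons size_map size_enum_ord.
- by move=> u; rewrite mem_rcons inE => /predU1P [->|/hg'].
- by rewrite adjs_rcons -/I' -JE'.
rewrite regular_seq_rcons -/I' => -[rg' rf0'] _ _ _.
have sgg' : size g = size g' by rewrite sg size_map size_enum_ord.
have dII' : forall j, hdim I j = hdim I' j.
  exact: (hdim_regular_seq h0 h0 sgg' hg hg' rg rg').
pose t := (n * e.-1)%N.
have te : (n.+1 * e.-1 = t + e.-1)%N by rewrite mulSn addnC.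
have Te : (n.+1 * (d - 2) = t + e.-1)%N by rewrite -te /e; congr (_ * _)%N; lia.
rewrite te in soc full codim; rewrite Te in hct.
(* The product [b * f0] has degree [t.-1 - k + e = T - k], where the two Milnor algebras have equal
   dimension. *)
have colI b : (k < t)%N -> b \is (t.-1 - k).-homog -> I (b * f0) -> I b.
  move=> kt; apply: (hdim_adj_colon_eq hI hI' hf0 hf0' rf0' dII').
  rewrite -JE -JE'; apply: (eq_milnor_dim hf hfs).
  have -> : (t.-1 - k + e = t + e.-1 - k)%N by lia.
  by apply: hct; lia.
have [N hN] := saturation_power hJ hs hl sats.
(* Large enough for [l ^+ r] to carry [s] into [J] and for surjectivity in degree [k + r]. *)
pose r := (N + t + e)%N.
have hlr : l ^+ r \is r.-homog by exact: linear_form_powX.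
apply: (milnor_dim_surjective hf hlr _ _ hs).
- by apply: hst; exact: leq_addr.
- have tem : (t + e <= k + r)%N by rewrite /r; lia.
  have := section_surjective hI e0 hl rl soc full codim hf0 tem (leq_addr r k) colI.
  by rewrite -JE addKn.
- by apply: hN; rewrite /r -addnA leq_addr.
Qed.

(** By Euler's identity some partial derivative is nonzero, and it is a constant. *)
Lemma linear_jacobian (f : S) : f \is 1.-homog -> f != 0 -> jacobian_ideal f = setT.
Proof.
move=> hf f0; have hJ := jacobian_hideal hf.
have [i fi] : exists i, f^`M(i) != 0.
  apply: contrapT => h; move/eqP: f0; apply.
  rewrite -[f]scale1r -(euler_identity hf) big1 // => i _.
  have [->|fi] := eqVneq f^`M(i) 0; first by rewrite mulr0.
  by case: h; exists i.
set c := (f^`M(i))@_0%MM; have fc : f^`M(i) = c%:MP.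
  apply/mpolyP => m; rewrite mcoeffC; case: (m =P 0%MM) => [->|/eqP m0].
    by rewrite mulr1.
  rewrite mulr0; apply: (dhomog_nemf_coeff (mderiv_homog i hf)).
  by rewrite -lt0n lt0n mdeg_eq0.
have c0 : c != 0 by apply: contraNneq fi => c0; rewrite fc c0 mpolyC0.
apply/seteqP; split=> // p _; rewrite -[p]mulr1; apply: (hidealM hJ).
apply: (hidealZK hJ c0); rewrite -mul_mpolyC mulr1 -fc.
exact: jacobian_gen.
Qed.

End Saturation.

(** * From inequalities between thresholds to equalities of dimensions *)

Section ThresholdValues.
Variables (R : realType) (n : nat).
Implicit Types f fs : {mpoly R[i][n.+1]}.

(** If all admissible [q] exceeded [k], the infimum would be at least [k.+1]; this includes the
    empty set, with infimum [+oo]. *)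
Lemma stability_threshold_le f k : (stability_threshold f <= (k%:R)%:E)%E ->
  forall j, (k <= j)%N -> milnor_dim f j = milnor_dim f k.
Proof.
move=> h.
have [q qk hq] : exists2 q, (q <= k)%N &
    forall j, (q <= j)%N -> milnor_dim f j = total_tjurina f.
  apply: contrapT => nq.
  suff : ((k.+1%:R)%:E <= stability_threshold f)%E.
    by move=> /le_trans /(_ h); rewrite lee_fin ler_nat ltnn.
  apply: le_ereal_inf_tmp => _ [q hq <-]; rewrite lee_fin ler_nat ltnNge.
  by apply/negP => qk; apply: nq; exists q.
by move=> j kj; rewrite !hq // (leq_trans qk).
Qed.

Lemma coincidence_threshold_ge f fs k N :
  ((N%:R)%:E - coincidence_threshold f fs <= (k%:R)%:E)%E -> (k <= N)%N ->
  milnor_dim f (N - k) = milnor_dim fs (N - k).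
Proof.
move=> h kN.
have [q qk hq] : exists2 q, (N - k <= q)%N &
    forall j, (j <= q)%N -> milnor_dim f j = milnor_dim fs j; last exact: hq.
apply: contrapT => nq.
(* The subtraction is in [R]: for [k = N] the bound is -1, and then no [q] is admissible. *)
suff hc : (coincidence_threshold f fs <= (N%:R - k.+1%:R)%:E)%E.
  suff : ((k.+1%:R)%:E <= (N%:R)%:E - coincidence_threshold f fs)%E.
    by move=> /le_trans /(_ h); rewrite lee_fin ler_nat ltnn.
  have -> : (k.+1%:R)%:E = ((N%:R)%:E - (N%:R - k.+1%:R)%:E : \bar R)%E.
    by rewrite -EFinB opprB addrC subrK.
  exact: leeB.
apply: ge_ereal_sup => _ [q hq <-]; rewrite lee_fin lerBrDr -natrD ler_nat addnS.
by rewrite ltnNge; apply/negP => qk; apply: nq; exists q; rewrite // leq_subLR addnC.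
Qed.

End ThresholdValues.

Theorem corollary1p2 (R : realType) (n d : nat) (f fs : {mpoly R[i][n.+1]})
    (hd : (0 < d)%N)
    (hf : f \is d.-homog) (hf0 : f != 0) (hiso : isolated_singularities f)
    (hfs : fs \is d.-homog) (hsmooth : smooth_hypersurface fs) :
  let J := jacobian_ideal f in
  let T : R := n.+1%:R * (d%:R - 2) in
  forall k : nat,
    (Order.max (T%:E - coincidence_threshold f fs) (stability_threshold f)
       <= (k%:R)%:E)%E ->
    saturation J `&` homog_comp k = J `&` homog_comp k.
Proof.
move=> J T k; rewrite ge_max => /andP [hct hst].
have hJ : homog_ideal J := jacobian_hideal hf.
apply/seteqP; split=> s [sJ sk]; split=> //; last first.
  by move=> i; exists 1%N => //; exact: hidealM.
(* For [d = 1] the truncated [d - 2] would not match [T]; there the Jacobian ideal is the whole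
   ring. *)
have [d1|d1] := leqP d 1.
  have dE : d = 1%N by lia.
  by rewrite dE in hf; rewrite /J (linear_jacobian hf hf0).
have hct' : (k <= n.+1 * (d - 2))%N ->
    milnor_dim f (n.+1 * (d - 2) - k) = milnor_dim fs (n.+1 * (d - 2) - k).
  apply: coincidence_threshold_ge.
  by have -> : (n.+1 * (d - 2))%:R = T by rewrite natrM natrB.
exact: (saturation_eq d1 hf hiso hfs hsmooth (stability_threshold_le hst) hct' sk sJ).
Qed.
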